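(* Each of the following three problems for $\mathrm{HyperQPTL^+}$ is equivalent (inter-reducible) to truth in third-order arithmetic: (i) satisfiability: given a sentence $\phi$, is there a nonempty set $T$ of traces with $T\models\phi$; (ii) finite-state satisfiability: given a sentence $\phi$, is there a (finite) transition system $\mathfrak{T}$ with $\mathfrak{T}\models\phi$; (iii) model-checking: given a sentence $\phi$ and a finite transition system $\mathfrak{T}$, does $\mathfrak{T}\models\phi$ hold.
   Context: $\mathrm{AP}$ is a nonempty finite set of atomic propositions; a trace is an element of $(2^{\mathrm{AP}})^\omega$. For $\mathrm{AP}'\subseteq\mathrm{AP}$, $T=_{\mathrm{AP}'}T'$ means the projections of the trace sets $T,T'$ onto $\mathrm{AP}'$ coincide. $\mathrm{HyperQPTL^+}$: formulas $\phi ::= \exists\pi.\phi\mid\forall\pi.\phi\mid\exists q.\phi\mid\forall q.\phi\mid\psi$, $\psi::=p_\pi\mid\neg\psi\mid\psi\vee\psi\mid\mathbf{X}\psi\mid\mathbf{F}\psi$ ($p,q\in\mathrm{AP}$, $\pi$ a trace variable); semantics over a set $T$ of traces, a trace assignment $\Pi$, and position $i$: $p_\pi$ holds iff $p\in\Pi(\pi)(i)$, Boolean and temporal operators as usual ($\mathbf{X}$: next position; $\mathbf{F}$: some position $\ge i$), $\exists\pi$/$\forall\pi$ range over $t\in T$, and $T,\Pi,i\models\exists q.\phi$ (resp. $\forall q.\phi$) iff for some (resp. all) $T'\subseteq(2^{\mathrm{AP}})^\omega$ with $T=_{\mathrm{AP}\setminus\{q\}}T'$ we have $T',\Pi,i\models\phi$.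 A sentence has all trace variables bound; $T\models\phi$ iff $T,\Pi_\emptyset,0\models\phi$. A transition system $\mathfrak{T}=(V,E,I,\lambda)$ has a finite nonempty vertex set $V$, edges $E\subseteq V\times V$ with every vertex having an outgoing edge, nonempty initial set $I\subseteq V$, and labeling $\lambda:V\to2^{\mathrm{AP}}$; its trace set $\mathrm{Tr}(\mathfrak{T})$ consists of $\lambda(\rho(0))\lambda(\rho(1))\cdots$ for infinite paths $\rho$ starting in $I$; $\mathfrak{T}\models\phi$ iff $\mathrm{Tr}(\mathfrak{T})\models\phi$. Truth in third-order arithmetic is the problem of deciding, for a sentence $\phi$ of third-order arithmetic (signature $(+,\cdot,<,\in)$, quantification over natural numbers, sets of natural numbers, and sets of sets of natural numbers), whether $(\mathbb{N},+,\cdot,<,\in)\models\phi$. *)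

(* Defs.v *)
From mathcomp Require Import all_boot.
From mathcomp Require Import classical_sets.
Set Implicit Arguments.
Unset Strict Implicit.
Unset Printing Implicit Defensive.

Local Open Scope classical_set_scope.

Definition update (A : Type) (f : nat -> A) (x : nat) (a : A) : nat -> A :=
  fun y => if y == x then a else f y.

(* The model of computation is the weak call-by-value lambda-calculus, in de
   Bruijn notation. Only closed terms are ever substituted when a closed term
   is evaluated, so that substitution need not shift indices. *)
Inductive term : Type :=
| Var of nat
| App of term & term
| Lam of term.

Fixpoint subst (s : term) (k : nat) (u : term) : term :=
  match s with
  | Var n => if n == k then u else Var n
  | App s1 s2 => App (subst s1 k u) (subst s2 k u)
  | Lam s1 => Lam (subst s1 k.+1 u)
  end.

Fixpoint closed_under (k : nat) (s : term) : bool :=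
  match s with
  | Var n => n < k
  | App s1 s2 => closed_under k s1 && closed_under k s2
  | Lam s1 => closed_under k.+1 s1
  end.

Inductive eval : term -> term -> Prop :=
| EvalLam s : eval (Lam s) (Lam s)
| EvalApp s t s' v w :
    eval s (Lam s') -> eval t v -> eval (subst s' 0 v) w -> eval (App s t) w.

(* Instances of decision problems are coded by binary trees, and binary trees
   are represented as lambda-terms by their Scott encoding. *)
Inductive tree : Type :=
| Leaf
| Node of tree & tree.

Fixpoint scott (d : tree) : term :=
  match d with
  | Leaf => Lam (Lam (Var 1))
  | Node a b => Lam (Lam (App (App (Var 0) (scott a)) (scott b)))
  end.

Record problem : Type := Problem {
  instance : Type;
  code : instance -> tree;
  holds : instance -> Prop
}.

Definition computable (P Q : problem) (f : instance P -> instance Q) : Prop :=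
  exists2 s : term, closed_under 0 s &
    forall x : instance P, eval (App s (scott (code x))) (scott (code (f x))).

(* Many-one reducibility by a total computable function. *)
Definition reducible (P Q : problem) : Prop :=
  exists2 f : instance P -> instance Q, computable f &
    forall x : instance P, holds x <-> holds (f x).

Definition equivalent (P Q : problem) : Prop := reducible P Q /\ reducible Q P.

Fixpoint code_nat (n : nat) : tree :=
  if n is m.+1 then Node Leaf (code_nat m) else Leaf.

Definition code_seq (s : seq tree) : tree := foldr Node Leaf s.

Definition code_nats (s : seq nat) : tree := code_seq (map code_nat s).

(* The node of a syntax tree with constructor number [k] and arguments [s]. *)
Definition code_con (k : nat) (s : seq tree) : tree :=
  Node (code_nat k) (code_seq s).

Section HyperQPTLplus.

Variable AP : finType.

Definition trace : Type := nat -> {set AP}.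

Definition proj (A : {set AP}) (t : trace) : trace := fun i => t i :&: A.

Definition eq_on (A : {set AP}) (T T' : set trace) : Prop :=
  proj A @` T = proj A @` T'.

Inductive qf_formula : Type :=
| Atom of AP & nat
| Neg of qf_formula
| Or of qf_formula & qf_formula
| Next of qf_formula
| Eventually of qf_formula.

Inductive formula : Type :=
| ExTrace of nat & formula
| AllTrace of nat & formula
| ExProp of AP & formula
| AllProp of AP & formula
| QF of qf_formula.

Definition assignment : Type := nat -> option trace.

Definition empty_assignment : assignment := fun _ => None.

Fixpoint qf_sat (Pi : assignment) (i : nat) (psi : qf_formula) : Prop :=
  match psi with
  | Atom p x => if Pi x is Some t then p \in t i else False
  | Neg psi1 => ~ qf_sat Pi i psi1
  | Or psi1 psi2 => qf_sat Pi i psi1 \/ qf_sat Pi i psi2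
  | Next psi1 => qf_sat Pi i.+1 psi1
  | Eventually psi1 => exists j : nat, i <= j /\ qf_sat Pi j psi1
  end.

Fixpoint sat (T : set trace) (Pi : assignment) (i : nat) (phi : formula) :
    Prop :=
  match phi with
  | ExTrace x phi1 => exists t : trace, T t /\ sat T (update Pi x (Some t)) i phi1
  | AllTrace x phi1 => forall t : trace, T t -> sat T (update Pi x (Some t)) i phi1
  | ExProp q phi1 =>
      exists T' : set trace, eq_on [set~ q]%SET T T' /\ sat T' Pi i phi1
  | AllProp q phi1 =>
      forall T' : set trace, eq_on [set~ q]%SET T T' -> sat T' Pi i phi1
  | QF psi => qf_sat Pi i psi
  end.

Definition models (T : set trace) (phi : formula) : Prop :=
  sat T empty_assignment 0 phi.

Fixpoint qf_scoped (s : seq nat) (psi : qf_formula) : bool :=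
  match psi with
  | Atom _ x => x \in s
  | Neg psi1 | Next psi1 | Eventually psi1 => qf_scoped s psi1
  | Or psi1 psi2 => qf_scoped s psi1 && qf_scoped s psi2
  end.

Fixpoint scoped (s : seq nat) (phi : formula) : bool :=
  match phi with
  | ExTrace x phi1 | AllTrace x phi1 => scoped (x :: s) phi1
  | ExProp _ phi1 | AllProp _ phi1 => scoped s phi1
  | QF psi => qf_scoped s psi
  end.

Record tsystem (V : finType) : Type := TSystem {
  edge : rel V;
  init : {set V};
  label : V -> {set AP};
  edge_total : forall v : V, exists w : V, edge v w;
  init_nonempty : exists v : V, v \in init  (* so [V] is nonempty as well *)
}.

Definition path_of (V : finType) (S : tsystem V) (rho : nat -> V) : Prop :=
  rho 0 \in init S /\ forall i : nat, edge S (rho i) (rho i.+1).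

Definition traces (V : finType) (S : tsystem V) : set trace :=
  [set t | exists2 rho : nat -> V, path_of S rho &
                                   t = (fun i => label S (rho i))].

End HyperQPTLplus.

(* The finite nonempty set of atomic propositions is part of the input: it is
   {0, ..., n} for a sentence [HSentence n _ _]. *)
Record hsentence : Type := HSentence {
  ap_max : nat;
  hformula : formula 'I_ap_max.+1;
  hformula_closed : scoped [::] hformula
}.

Fixpoint code_qf (n : nat) (psi : qf_formula 'I_n) : tree :=
  match psi with
  | Atom p x => code_con 0 [:: code_nat p; code_nat x]
  | Neg psi1 => code_con 1 [:: code_qf psi1]
  | Or psi1 psi2 => code_con 2 [:: code_qf psi1; code_qf psi2]
  | Next psi1 => code_con 3 [:: code_qf psi1]
  | Eventually psi1 => code_con 4 [:: code_qf psi1]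
  end.

Fixpoint code_formula (n : nat) (phi : formula 'I_n) : tree :=
  match phi with
  | ExTrace x phi1 => code_con 0 [:: code_nat x; code_formula phi1]
  | AllTrace x phi1 => code_con 1 [:: code_nat x; code_formula phi1]
  | ExProp q phi1 => code_con 2 [:: code_nat q; code_formula phi1]
  | AllProp q phi1 => code_con 3 [:: code_nat q; code_formula phi1]
  | QF psi => code_con 4 [:: code_qf psi]
  end.

Definition code_hsentence (phi : hsentence) : tree :=
  Node (code_nat (ap_max phi)) (code_formula (hformula phi)).

(* The list of initial vertices, and for each vertex the pair of its list of
   successors and the list of propositions in its label. *)
Definition code_tsystem (n m : nat) (S : tsystem 'I_n 'I_m) : tree :=
  Node (code_nats [seq val v | v <- enum 'I_m & v \in init S])
       (code_seq [seq Node (code_nats [seq val w | w <- enum 'I_m & edge S v w])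
                           (code_nats [seq val p | p <- enum 'I_n
                                                 & p \in label S v])
                 | v <- enum 'I_m]).

Definition satisfiability : problem :=
  @Problem hsentence code_hsentence (fun phi =>
    exists T : set (trace 'I_(ap_max phi).+1),
      T !=set0 /\ models T (hformula phi)).

Definition finite_state_satisfiability : problem :=
  @Problem hsentence code_hsentence (fun phi =>
    exists (V : finType) (S : tsystem 'I_(ap_max phi).+1 V),
      models (traces S) (hformula phi)).

(* In an input, the vertices of the transition system are 0, ..., m - 1. *)
Record mc_input : Type := MCInput {
  mc_sentence : hsentence;
  mc_size : nat;
  mc_system : tsystem 'I_(ap_max mc_sentence).+1 'I_mc_size
}.

Definition code_mc_input (x : mc_input) : tree :=
  Node (code_hsentence (mc_sentence x)) (code_tsystem (mc_system x)).

Definition model_checking : problem :=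
  @Problem mc_input code_mc_input (fun x =>
    models (traces (mc_system x)) (hformula (mc_sentence x))).

Inductive aterm : Type :=
| AVar of nat
| APlus of aterm & aterm
| AMult of aterm & aterm.

(* The variables of the three sorts (numbers, sets of numbers, sets of sets of
   numbers) are named by natural numbers independently of each other. [AMem1] is
   membership of a number in a set, [AMem2] of a set in a set of sets, and
   [AEq1], [AEq2] are the equalities of the two higher sorts; conjunction and
   universal quantification are abbreviations. *)
Inductive aformula : Type :=
| AEq of aterm & aterm
| ALt of aterm & aterm
| AMem1 of aterm & nat
| AMem2 of nat & nat
| AEq1 of nat & nat
| AEq2 of nat & nat
| ANot of aformula
| AOr of aformula & aformula
| AEx0 of nat & aformula
| AEx1 of nat & aformula
| AEx2 of nat & aformula.

Fixpoint aterm_val (e : nat -> nat) (t : aterm) : nat :=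
  match t with
  | AVar x => e x
  | APlus t1 t2 => aterm_val e t1 + aterm_val e t2
  | AMult t1 t2 => aterm_val e t1 * aterm_val e t2
  end.

Fixpoint asat (e0 : nat -> nat) (e1 : nat -> set nat)
    (e2 : nat -> set (set nat)) (phi : aformula) : Prop :=
  match phi with
  | AEq t1 t2 => aterm_val e0 t1 = aterm_val e0 t2
  | ALt t1 t2 => aterm_val e0 t1 < aterm_val e0 t2
  | AMem1 t x => e1 x (aterm_val e0 t)
  | AMem2 x y => e2 y (e1 x)
  | AEq1 x y => e1 x = e1 y
  | AEq2 x y => e2 x = e2 y
  | ANot phi1 => ~ asat e0 e1 e2 phi1
  | AOr phi1 phi2 => asat e0 e1 e2 phi1 \/ asat e0 e1 e2 phi2
  | AEx0 x phi1 => exists a : nat, asat (update e0 x a) e1 e2 phi1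
  | AEx1 x phi1 => exists a : set nat, asat e0 (update e1 x a) e2 phi1
  | AEx2 x phi1 => exists a : set (set nat), asat e0 e1 (update e2 x a) phi1
  end.

Fixpoint aterm_scoped (s : seq nat) (t : aterm) : bool :=
  match t with
  | AVar x => x \in s
  | APlus t1 t2 | AMult t1 t2 => aterm_scoped s t1 && aterm_scoped s t2
  end.

Fixpoint ascoped (s0 s1 s2 : seq nat) (phi : aformula) : bool :=
  match phi with
  | AEq t1 t2 | ALt t1 t2 => aterm_scoped s0 t1 && aterm_scoped s0 t2
  | AMem1 t x => aterm_scoped s0 t && (x \in s1)
  | AMem2 x y => (x \in s1) && (y \in s2)
  | AEq1 x y => (x \in s1) && (y \in s1)
  | AEq2 x y => (x \in s2) && (y \in s2)
  | ANot phi1 => ascoped s0 s1 s2 phi1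
  | AOr phi1 phi2 => ascoped s0 s1 s2 phi1 && ascoped s0 s1 s2 phi2
  | AEx0 x phi1 => ascoped (x :: s0) s1 s2 phi1
  | AEx1 x phi1 => ascoped s0 (x :: s1) s2 phi1
  | AEx2 x phi1 => ascoped s0 s1 (x :: s2) phi1
  end.

Fixpoint code_aterm (t : aterm) : tree :=
  match t with
  | AVar x => code_con 0 [:: code_nat x]
  | APlus t1 t2 => code_con 1 [:: code_aterm t1; code_aterm t2]
  | AMult t1 t2 => code_con 2 [:: code_aterm t1; code_aterm t2]
  end.

Fixpoint code_aformula (phi : aformula) : tree :=
  match phi with
  | AEq t1 t2 => code_con 0 [:: code_aterm t1; code_aterm t2]
  | ALt t1 t2 => code_con 1 [:: code_aterm t1; code_aterm t2]
  | AMem1 t x => code_con 2 [:: code_aterm t; code_nat x]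
  | AMem2 x y => code_con 3 [:: code_nat x; code_nat y]
  | AEq1 x y => code_con 4 [:: code_nat x; code_nat y]
  | AEq2 x y => code_con 5 [:: code_nat x; code_nat y]
  | ANot phi1 => code_con 6 [:: code_aformula phi1]
  | AOr phi1 phi2 => code_con 7 [:: code_aformula phi1; code_aformula phi2]
  | AEx0 x phi1 => code_con 8 [:: code_nat x; code_aformula phi1]
  | AEx1 x phi1 => code_con 9 [:: code_nat x; code_aformula phi1]
  | AEx2 x phi1 => code_con 10 [:: code_nat x; code_aformula phi1]
  end.

Record asentence : Type := ASentence {
  asentence_formula : aformula;
  asentence_closed : ascoped [::] [::] [::] asentence_formula
}.

(* The assignments are irrelevant, a sentence having no free variable. *)
Definition third_order_truth : problem :=
  @Problem asentence (fun phi => code_aformula (asentence_formula phi))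
    (fun phi => asat (fun=> 0) (fun=> set0) (fun=> set0)
                     (asentence_formula phi)).

(* Main.v *)
From mathcomp Require Import all_boot boolp classical_sets.
From mathcomp Require Import zify.
Require Import Defs.
Set Implicit Arguments.
Unset Strict Implicit.
Unset Printing Implicit Defensive.
Local Open Scope classical_set_scope.

(* Computability is obtained from hereditary total realizability: every function
   on trees written with pairing and structural recursion at arbitrary finite
   types is computed by a lambda-term. All translations are such functions on
   syntax trees, and a reduction only needs that they map codes to codes of
   equivalent instances.

   From third-order arithmetic to HyperQPTL+: the traces of the model represent,
   through proposition 0, all sets of numbers, which the prefix of the sentence
   enforces; a number is a singleton, and a set of sets is given by the traces
   that carry a quantified proposition at position 0. Addition and multiplication
   are defined as least families of two-element sets. Since quantifiers must be
   in prenex form, the translation is in continuation-passing style. Because of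
   the enforced fullness the same sentence serves all three problems, with a
   two-vertex transition system generating all sets.

   From HyperQPTL+ to third-order arithmetic: traces are sets of numbers through
   a bijection, so the semantics is expressed literally, and a finite transition
   system is a tuple of a number and three sets of numbers. *)

(** The quantifier-free part reads all traces synchronously. It expresses order and successor but
    gives no direct access to sums, whence the detour through families of sets. A pair is coded by
    the unordered set [{b, c}], which can be decoded only because [b <= c]; this is the origin of
    the order conditions and of the separate case of a factor 0.

    A proposition quantifier replaces the whole trace set for everything in its scope, so a trace
    bound earlier may lie outside the current set. What survives are the sets of numbers shown by
    proposition 0 and the marks left by earlier propositions, and the invariants speak of these
    only. Each set of sets needs its own proposition, and the number of propositions is part of the
    instance; so every piece of the translation carries a bound on the names it uses.

    Fullness is itself asserted by the sentence, whose truth value must therefore be known in trace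
    sets that are not full as well: correctness of the translation is stated relative to the family
    [U] of the sets at hand. *)

(** * Simultaneous substitution and evaluation of lambda-terms *)

Fixpoint msubst (s : term) (k : nat) (vs : seq term) : term :=
  match s with
  | Var n => if n < k then Var n else nth (Var n) vs (n - k)
  | App s1 s2 => App (msubst s1 k vs) (msubst s2 k vs)
  | Lam s1 => Lam (msubst s1 k.+1 vs)
  end.

Lemma closed_under_le k k' s : k <= k' -> closed_under k s -> closed_under k' s.
Proof.
elim: s k k' => [n|s1 IH1 s2 IH2|s IH] k k' le_kk' /=.
- by move=> lt_nk; apply: leq_trans le_kk'.
- by case/andP=> /(IH1 _ _ le_kk') -> /(IH2 _ _ le_kk').
- by apply: IH.
Qed.

Lemma msubst_closed s k vs : closed_under k s -> msubst s k vs = s.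
Proof.
elim: s k => [n|s1 IH1 s2 IH2|s IH] k /=; first by move=> ->.
- by case/andP=> /IH1 -> /IH2 ->.
- by move/IH->.
Qed.

Lemma subst_closed s k u : closed_under k s -> subst s k u = s.
Proof.
elim: s k => [n|s1 IH1 s2 IH2|s IH] k /=.
- by move=> lt_nk; rewrite ltn_eqF.
- by case/andP=> /IH1 -> /IH2 ->.
- by move/IH->.
Qed.

Lemma closed_msubst s k vs : closed_under (k + size vs) s ->
  all (closed_under 0) vs -> closed_under k (msubst s k vs).
Proof.
elim: s k => [n|s1 IH1 s2 IH2|s IH] k /=.
- move=> lt_n cl; case: ltnP => //= le_kn.
  have lt_s : n - k < size vs by rewrite ltn_subLR.
  by apply: (closed_under_le (leq0n k)); apply: (all_nthP _ cl).
- by case/andP=> c1 c2 cl; rewrite IH1 ?IH2.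
- by move=> c1 cl; apply: IH.
Qed.

(** A beta-step below an environment [vs] amounts to extending the environment by [v]: the values in
    [vs] are closed, so the second substitution leaves them alone. Neither operation lowers the
    remaining indices, whence the default [Var n] in [msubst]. *)
Lemma subst_msubst s k v vs : all (closed_under 0) vs ->
  subst (msubst s k.+1 vs) k v = msubst s k (v :: vs).
Proof.
move=> cl; elim: s k => [n|s1 IH1 s2 IH2|s IH] k /=; last 2 first.
- by rewrite IH1 IH2.
- by rewrite IH.
case: (ltngtP n k) => [lt_nk|lt_kn|->].
- by rewrite ltnS ltnW //= ltn_eqF.
- rewrite ltnS leqNgt lt_kn /=.
  have -> : n - k = (n - k.+1).+1 by rewrite subnSK.
  case: (ltnP (n - k.+1) (size vs)) => lt_s /=.
    rewrite subst_closed //; apply: (closed_under_le (leq0n k)).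
    exact: (all_nthP _ cl).
  by rewrite !nth_default //= gtn_eqF.
- by rewrite ltnSn /= eqxx subnn.
Qed.

Lemma closed_scott d k : closed_under k (scott d).
Proof. by elim: d k => [|a IHa b IHb] k //=; rewrite IHa IHb. Qed.

Lemma eval_value s : (exists s', s = Lam s') -> eval s s.
Proof. by case=> s' ->; apply: EvalLam. Qed.

Lemma eval_idem s v w : eval s v -> eval v w -> v = w.
Proof. by elim=> {s v} [s e|s t s' v w' _ _ _ _ _ IH /IH //]; inversion e. Qed.

(** Since a value evaluates only to itself, a composite program may be evaluated from the values of
    its two parts. *)
Lemma eval_app s t v u w :
  eval s v -> eval t u -> eval (App v u) w -> eval (App s t) w.
Proof.
move=> es et ew; inversion ew as [|s0 t0 s' u' w' e1 e2 e3]; subst.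
have def_v := eval_idem es e1; have def_u := eval_idem et e2; subst.
exact: EvalApp es et e3.
Qed.

Lemma scott_value d : exists s, scott d = Lam s.
Proof. by case: d; eexists. Qed.

(** * Realizers and programs with free variables *)

(* Hereditary total realizability: a tree is realized by its Scott encoding, and
   a function by a closed value mapping realizers to realizers. *)
Class rep (X : Type) := Rep {
  rz : X -> term -> Prop;
  rz_value : forall x v, rz x v -> closed_under 0 v /\ exists s, v = Lam s
}.

#[refine] Instance rep_tree : rep tree := {| rz d v := v = scott d |}.
Proof. by move=> d v ->; split; [apply: closed_scott | apply: scott_value]. Defined.

#[refine] Instance rep_fun (X Y : Type) {rX : rep X} {rY : rep Y} : rep (X -> Y) :=
  {| rz f v := [/\ closed_under 0 v, exists s, v = Lam s &
       forall x u, rz x u -> exists2 w, eval (App v u) w & rz (f x) w] |}.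
Proof. by move=> f v []. Defined.

(** The free variables of a program form a left-nested tuple with the most recent one last; the list
    of their realizers has it first, at de Bruijn index 0. *)
Class ctx (E : Type) := Ctx {
  csize : nat;
  crz : E -> seq term -> Prop;
  crz_size : forall e vs, crz e vs -> size vs = csize;
  crz_closed : forall e vs, crz e vs -> all (closed_under 0) vs
}.
Arguments csize E {_}.

#[refine] Instance ctx_unit : ctx unit := {| csize := 0; crz _ vs := vs = [::] |}.
Proof. by move=> _ vs ->. by move=> _ vs ->. Defined.

#[refine] Instance ctx_pair (E X : Type) {cE : ctx E} {rX : rep X} : ctx (E * X) :=
  {| csize := (csize E).+1;
     crz e vs := exists v us, [/\ vs = v :: us, rz e.2 v & crz e.1 us] |}.
Proof.
- by move=> e vs [v [us [-> _ cr]]]; rewrite /= (crz_size cr).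
- by move=> e vs [v [us [-> rv cr]]]; rewrite /= (crz_closed cr) (rz_value rv).1.
Defined.

Definition comp (E X : Type) {cE : ctx E} {rX : rep X} (f : E -> X) : Prop :=
  exists2 s, closed_under (csize E) s &
    forall e vs, crz e vs -> exists2 v, eval (msubst s 0 vs) v & rz (f e) v.

Definition real (X : Type) {rX : rep X} (x : X) : Prop := exists v, rz x v.

(** Here [p] forgets the [k] innermost variables, so that [(p e).2] is the variable of index [k]. *)
Definition cproj (E E' : Type) {cE : ctx E} {cE' : ctx E'} (p : E -> E') k : Prop :=
  csize E = k + csize E' /\ forall e vs, crz e vs -> crz (p e) (drop k vs).

Section Comp.
Context {E : Type} {cE : ctx E}.

Lemma cproj_id : cproj (fun e : E => e) 0.
Proof. by split=> // e vs; rewrite drop0. Qed.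

Lemma cproj_fst (E' Y : Type) {cE' : ctx E'} {rY : rep Y} (p : E -> E' * Y) k :
  cproj p k -> cproj (fun e => (p e).1) k.+1.
Proof.
case=> sz pP; split=> [|e vs /pP[v [us [eq_vs _ cr]]]]; first by rewrite sz addSnnS.
by rewrite -add1n -drop_drop eq_vs /= drop0.
Qed.

Lemma comp_var (E' Y : Type) {cE' : ctx E'} {rY : rep Y} (p : E -> E' * Y) k :
  cproj p k -> comp (fun e => (p e).2).
Proof.
case=> sz pP; exists (Var k) => /= [|e vs /pP[v [us [eq_vs rv _]]]].
  by rewrite sz /= -[ltnLHS]addn0 ltn_add2l.
exists v => //; rewrite subn0 -[k]addn0 -nth_drop eq_vs /=.
by have [_ [s ->]] := rz_value rv; apply: EvalLam.
Qed.

Lemma comp_const (X : Type) {rX : rep X} (x : X) : real x -> comp (fun _ : E => x).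
Proof.
case=> v rv; have [cl [s def_v]] := rz_value rv.
exists v => [|e vs _]; first exact: closed_under_le cl.
by exists v => //; rewrite msubst_closed // def_v; apply: EvalLam.
Qed.

Lemma comp_app (X Y : Type) {rX : rep X} {rY : rep Y} (f : E -> X -> Y) (a : E -> X) :
  comp f -> comp a -> comp (fun e => f e (a e)).
Proof.
move=> [sf cf fP] [sa ca aP]; exists (App sf sa) => /= [|e vs cr]; first by rewrite cf.
have [vf ef [_ _ rf]] := fP _ _ cr; have [va ea ra] := aP _ _ cr.
by have [w ew rw] := rf _ _ ra; exists w => //; apply: eval_app ew.
Qed.

Lemma comp_lam (X Y : Type) {rX : rep X} {rY : rep Y} (f : E -> X -> Y) :
  comp (fun e : E * X => f e.1 e.2) -> comp f.
Proof.
case=> s cs sP; exists (Lam s) => //= e vs cr.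
exists (Lam (msubst s 1 vs)); first exact: EvalLam.
have cl := crz_closed cr; split; first 2 last.
- move=> x u ru; have [cu [su def_u]] := rz_value ru.
  have cr' : crz (e, x) (u :: vs) by exists u, vs.
  have [w ew rw] := sP _ _ cr'; exists w => //.
  apply: (EvalApp (EvalLam _) (v := u)); first by rewrite def_u; apply: EvalLam.
  by rewrite subst_msubst.
- by apply: (@closed_msubst s 1) => //; rewrite (crz_size cr).
- by eexists.
Qed.

End Comp.

Lemma real_comp (X : Type) {rX : rep X} (x : X) : comp (fun _ : unit => x) -> real x.
Proof. by case=> s _ /(_ tt [::] erefl)[v _ rv]; exists v. Qed.

(** * Structural recursion on trees, and the tactic that finds realizers *)

Fixpoint trec (X : Type) (x : X) (f : tree -> tree -> X -> X -> X) (d : tree) : X :=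
  if d is Node a b then f a b (trec x f a) (trec x f b) else x.

Lemma real_Leaf : real Leaf. Proof. by exists (scott Leaf). Qed.

Lemma real_Node : real Node.
Proof.
exists (Lam (Lam (Lam (Lam (App (App (Var 0) (Var 3)) (Var 2)))))).
split=> //; first by eexists.
move=> a _ ->; eexists.
  apply: EvalApp; [exact: EvalLam | exact: eval_value (scott_value _) | exact: EvalLam].
rewrite /=; split=> //=; [by rewrite closed_scott | by eexists|].
move=> b _ ->; eexists; last reflexivity.
apply: EvalApp; [exact: EvalLam | exact: eval_value (scott_value _) |] => /=.
rewrite subst_closed ?closed_scott //; exact: EvalLam.
Qed.

(* Self-application of [rec_body x f] computes [trec x f]; the branches given to
   a Scott-encoded tree are values, so call-by-value evaluation terminates. *)
Definition rec_body (x f : term) : term :=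
  Lam (Lam (App (App (Var 0) x)
    (Lam (Lam (App (App (App (App f (Var 1)) (Var 0))
                        (App (App (Var 3) (Var 3)) (Var 1)))
                   (App (App (Var 3) (Var 3)) (Var 0))))))).

Lemma real_trec (X : Type) {rX : rep X} : real (@trec X).
Proof.
exists (Lam (Lam (App (rec_body (Var 3) (Var 4)) (rec_body (Var 3) (Var 4))))).
split=> //; first by eexists.
move=> x vx rx; have [cx valx] := rz_value rx.
have c k : closed_under k vx by apply: closed_under_le cx.
exists (Lam (App (rec_body vx (Var 4)) (rec_body vx (Var 4)))).
  apply: EvalApp; [exact: EvalLam | exact: eval_value | exact: EvalLam].
split=> //=; [by rewrite !c | by eexists |].
move=> f vf rf; have [cf valf _] := rf.
have {}cf k : closed_under k vf by apply: closed_under_le cf.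
set W := rec_body vx vf.
have cW k : closed_under k W by rewrite /= !c !cf.
(* The value of [W W] is [V], the recursor itself; [L] is its branch for [Node], which calls [W W]
   anew on both subtrees. *)
pose L := Lam (Lam (App (App (App (App vf (Var 1)) (Var 0)) (App (App W W) (Var 1)))
                        (App (App W W) (Var 0)))).
pose V := Lam (App (App (Var 0) vx) L).
have eWW : eval (App W W) V.
  apply: EvalApp; [exact: EvalLam | exact: EvalLam |].
  by rewrite /= !subst_closed //; apply: EvalLam.
exists V.
  apply: EvalApp; [exact: EvalLam | exact: eval_value |].
  by rewrite /= !subst_closed.
split; [by rewrite /= !c !cf | by eexists |] => d _ ->.
elim: d => [|a IHa b IHb].
  exists vx => //.
  apply: EvalApp; [exact: EvalLam | exact: eval_value (scott_value _) |].
  rewrite /= !subst_closed //=; try by rewrite ?c ?cf.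
  apply: (@EvalApp _ _ vx L); last by rewrite subst_closed //; apply: eval_value.
    by apply: EvalApp; [exact: EvalLam | exact: eval_value | exact: EvalLam].
  exact: EvalLam.
have [wa ea ra] := IHa; have [wb eb rb] := IHb.
have [w1 e1 r1] : exists2 w, eval (App vf (scott a)) w & rz (f a) w.
  by case: rf => _ _; apply.
have [w2 e2 r2] : exists2 w, eval (App w1 (scott b)) w & rz (f a b) w.
  by case: r1 => _ _; apply.
have [w3 e3 r3] : exists2 w, eval (App w2 wa) w & rz (f a b (trec x f a)) w.
  by case: r2 => _ _; apply.
have [w4 e4 r4] : exists2 w, eval (App w3 wb) w & rz (trec x f (Node a b)) w.
  by case: r3 => _ _; apply.
(* The induction hypotheses speak of [V], the recursive calls of [W W]. *)
have eWa d w : eval (App V (scott d)) w -> eval (App (App W W) (scott d)) w.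
  by move=> e; apply: eval_app eWW (eval_value (scott_value _)) e.
exists w4 => //.
apply: EvalApp; [exact: EvalLam | exact: eval_value (scott_value _) |].
rewrite /= !subst_closed ?closed_scott //=; try by rewrite ?c ?cf.
apply: (@EvalApp _ _ (App (App (Var 0) (scott a)) (scott b)) L).
- apply: EvalApp; [exact: EvalLam | exact: eval_value |].
  by rewrite /= !subst_closed ?closed_scott //; apply: EvalLam.
- exact: EvalLam.
rewrite /= !subst_closed ?closed_scott //.
apply: (@EvalApp _ _ (App (App (App (App vf (scott a)) (Var 0)) (App (App W W) (scott a)))
  (App (App W W) (Var 0))) (scott b)).
- apply: EvalApp; [exact: EvalLam | exact: eval_value (scott_value _) |].
  by rewrite [subst _ _ _]/= !subst_closed ?c ?cf //; apply: EvalLam.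
- exact: eval_value (scott_value _).
rewrite [subst _ _ _]/= !subst_closed ?closed_scott //=; try by rewrite ?c ?cf.
apply: eval_app (eWa _ _ eb) e4; apply: eval_app (eWa _ _ ea) e3.
by apply: eval_app e2; [apply: eval_app e1 |]; apply: eval_value => //; apply: scott_value.
Qed.

Create HintDb real.
#[local] Hint Resolve real_Leaf real_Node real_trec : real.

Ltac cproj := first [apply: cproj_id | apply: cproj_fst; cproj].

(** Reads a Rocq function as a program along its syntax: a subterm independent of the environment is
    first tried as a constant with a known realizer; otherwise variables, abstractions and
    applications become their counterparts in the lambda-calculus. *)
Ltac comp := cbv beta;
  lazymatch goal with
  | |- comp (fun _ => ?c) =>
    first [ apply: comp_const; solve [auto with real nocore] | comp_step ]
  | _ => comp_step
  end
with comp_step :=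
  lazymatch goal with
  | |- comp (fun e => snd (@?p e)) => apply: comp_var; cproj
  | |- comp (fun e x => @?b e x) => apply: comp_lam; comp
  | |- @comp ?E _ _ _ ?b =>
    let f := constr:(fun e : E => ltac:(let t := eval cbv beta in (b e) in
      lazymatch t with ?g _ => exact g end)) in
    let a := constr:(fun e : E => ltac:(let t := eval cbv beta in (b e) in
      lazymatch t with _ ?x => exact x end)) in
    apply: (@comp_app _ _ _ _ _ _ f a); comp
  end.

Ltac realize := apply: real_comp; comp.

(** Only the map on codes has to be computed. Instances contain proofs, and the map on instances is
    merely chosen so as to have the right codes. *)
Lemma reducible_by (P Q : problem) (F : tree -> tree) : real F ->
  (forall x : instance P, exists y : instance Q,
     code y = F (code x) /\ (holds x <-> holds y)) ->
  reducible P Q.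
Proof.
move=> [v [cv _ rv]] FP; have [f fP] := choice FP.
exists f => [|x]; last exact: (fP x).2.
exists v => // x; have [w ew def_w] := rv (code x) _ erefl.
by rewrite (fP x).1 -[scott (F _)]def_w.
Qed.

(** * Programs on numerals, syntax trees and environments *)

Notation tcase x f d := (trec x (fun a b _ _ => f a b) d).

Definition tif (b x y : tree) : tree := tcase y (fun _ _ => x) b.
Lemma real_tif : real tif. Proof. rewrite /tif; realize. Qed.

(** Compares right spines only, which decides equality of numerals; [Leaf] stands for false. *)
Definition teq : tree -> tree -> tree :=
  trec (fun d => tcase (code_nat 1) (fun _ _ => Leaf) d)
       (fun _ _ _ r d => tcase Leaf (fun _ d' => r d') d).
Lemma real_teq : real teq. Proof. rewrite /teq /code_nat; realize. Qed.

(** Nested occurrences form a switch on the constructor number of a syntax tree. *)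
Definition sw (X : Type) (x : X) (f : tree -> X) (d : tree) : X :=
  tcase x (fun _ d' => f d') d.
Lemma real_sw X {rX : rep X} : real (@sw X). Proof. rewrite /sw; realize. Qed.

Lemma real_tree (d : tree) : real d. Proof. by exists (scott d). Qed.
#[local] Hint Resolve real_tree real_tif real_teq real_sw : real.

(* Recursion over syntax trees [code_con k s]: the step function receives the
   results for the first two arguments in [s]. *)
Definition rose (X : Type) (x : X) (h : tree -> tree -> X -> X -> X) (d : tree) : X :=
  trec (fun _ => x) (fun a b fa fb =>
    sw (h a b (fb (code_nat 1)) (fb (code_nat 2))) (sw (fa Leaf) (fun _ => fb (code_nat 1))))
    d Leaf.
(** The recursion runs at the type [tree -> X]. Its numeral argument tells how a tree is read: 0 as
    a syntax node, 1 or 2 as an argument list whose first or second element is wanted. *)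
Lemma real_rose X {rX : rep X} : real (@rose X). Proof. rewrite /rose; realize. Qed.

Definition thd (d : tree) : tree := tcase Leaf (fun a _ => a) d.
Lemma real_thd : real thd. Proof. rewrite /thd; realize. Qed.

Definition tthd (d : tree) : tree := tcase Leaf (fun _ b => thd b) d.
#[local] Hint Resolve real_rose real_thd : real.
Lemma real_tthd : real tthd. Proof. rewrite /tthd; realize. Qed.

Definition tupd (r : tree -> tree) (x v : tree) : tree -> tree :=
  fun y => tif (teq x y) v (r y).
Lemma real_tupd : real tupd. Proof. rewrite /tupd; realize. Qed.

Definition con1 (k a : tree) : tree := Node k (Node a Leaf).
Lemma real_con1 : real con1. Proof. rewrite /con1; realize. Qed.

Definition con2 (k a b : tree) : tree := Node k (Node a (Node b Leaf)).
Lemma real_con2 : real con2. Proof. rewrite /con2; realize. Qed.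

Definition tS (d : tree) : tree := Node Leaf d.
Lemma real_tS : real tS. Proof. rewrite /tS; realize. Qed.
#[local] Hint Resolve real_tthd real_tupd real_con1 real_con2 real_tS : real.

Lemma tupd_code r x v y :
  tupd r (code_nat x) v (code_nat y) = if y == x then v else r (code_nat y).
Proof.
rewrite /tupd; suff ->: teq (code_nat x) (code_nat y) = code_nat (y == x) by case: eqP.
by elim: x y => [|x IH] [|y] //; apply: IH.
Qed.

Lemma code_nat_inj : injective code_nat.
Proof. by elim=> [|m IH] [|n] //= [/IH->]. Qed.

(** * Prenex translation into HyperQPTL+ *)

Definition qatom (p v : tree) : tree := con2 (code_nat 0) p v.
Definition qx (v : tree) : tree := qatom Leaf v.
Definition qneg (m : tree) : tree := con1 (code_nat 1) m.
Definition qor (m m' : tree) : tree := con2 (code_nat 2) m m'.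
Definition qnext (m : tree) : tree := con1 (code_nat 3) m.
Definition qev (m : tree) : tree := con1 (code_nat 4) m.
Definition qand (m m' : tree) : tree := qneg (qor (qneg m) (qneg m')).
Definition qalw (m : tree) : tree := qneg (qev (qneg m)).
Definition qiff (m m' : tree) : tree := qor (qand m m') (qand (qneg m) (qneg m')).

Definition qsub (a b : tree) : tree := qalw (qor (qneg (qx a)) (qx b)).
Definition qeq (a b : tree) : tree := qalw (qiff (qx a) (qx b)).
Definition qlt (a b : tree) : tree := qev (qand (qx a) (qnext (qev (qx b)))).
Definition qzero (a : tree) : tree := qx a.
Definition qshift (a b : tree) : tree :=
  qand (qneg (qx b)) (qalw (qiff (qx a) (qnext (qx b)))).
Definition qunion (a b p : tree) : tree := qalw (qiff (qx p) (qor (qx a) (qx b))).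
Definition qzunion (a p : tree) : tree := qand (qx p) (qnext (qalw (qiff (qx p) (qx a)))).
Definition qisz (p : tree) : tree := qand (qx p) (qnext (qalw (qneg (qx p)))).
Definition qsing (a : tree) : tree :=
  qand (qev (qx a)) (qalw (qor (qneg (qx a)) (qnext (qalw (qneg (qx a)))))).

(* A translation in continuation-passing style: it takes the next unused name,
   the polarity of the context, which is the number of the quantifier standing
   for an existential one there, and a continuation that receives the next
   unused name and the quantifier-free part. The name [v] stands both for the
   trace variable [v] and for the proposition [v.+1]. *)
Notation cps := (tree -> tree -> (tree -> tree -> tree) -> tree).

Definition c_atom (m : tree) : cps := fun c _ k => k c m.
Definition c_not (D : cps) : cps := fun c pol k =>
  D c (tif pol Leaf (code_nat 1)) (fun c' m => k c' (qneg m)).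
Definition c_or (D1 D2 : cps) : cps := fun c pol k =>
  D1 c pol (fun c1 m1 => D2 c1 pol (fun c2 m2 => k c2 (qor m1 m2))).
Definition c_ex1 (D : tree -> cps) : cps := fun c pol k =>
  con2 pol c (D c (tS c) pol k).
Definition c_ex2 (D : tree -> cps) : cps := fun c pol k =>
  con2 (tS (tS pol)) (tS c) (D c (tS c) pol k).
Definition c_and (D1 D2 : cps) : cps := c_not (c_or (c_not D1) (c_not D2)).
Definition c_imp (D1 D2 : cps) : cps := c_or (c_not D1) D2.
Definition c_all1 (D : tree -> cps) : cps := c_not (c_ex1 (fun v => c_not (D v))).
Definition c_all2 (D : tree -> cps) : cps := c_not (c_ex2 (fun v => c_not (D v))).
(** The trace bound to [x] may lie outside the current trace set, so whether it carries the
    proposition of [y] is meaningless. A new trace is drawn from the current set that shows the same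
    set of numbers, and its mark is inspected. *)
Definition c_mem (x y : tree) : cps :=
  c_ex1 (fun v => c_atom (qand (qeq v x) (qatom (tS y) v))).
Definition c_exn (D : tree -> cps) : cps :=
  c_ex1 (fun v => c_and (c_atom (qsing v)) (D v)).

(* [a + b = c] iff [{b, c}] lies in every family of sets that contains [{0, a}]
   and is closed under shifting, and [b <= c]. *)
Definition c_plus (a b c : tree) : cps :=
  c_and (c_not (c_atom (qlt c b)))
  (c_all2 (fun F =>
    c_imp (c_all1 (fun p => c_imp (c_atom (qzunion a p)) (c_mem p F)))
   (c_imp (c_all1 (fun p => c_all1 (fun p' =>
             c_imp (c_atom (qshift p p')) (c_imp (c_mem p F) (c_mem p' F)))))
          (c_all1 (fun p => c_imp (c_atom (qunion b c p)) (c_mem p F)))))).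

(* For [a > 0], [a * b = c] iff [{b, c}] lies in every family of sets that
   contains [{0}] and is closed under [{u, v} |-> {u + 1, v + a}] for [u <= v],
   and [b <= c]. *)
Definition c_mult (a b c : tree) : cps :=
  c_or (c_and (c_atom (qzero a)) (c_atom (qzero c)))
  (c_and (c_not (c_atom (qzero a)))
  (c_and (c_not (c_atom (qlt c b)))
  (c_all2 (fun F =>
    c_imp (c_all1 (fun p => c_imp (c_atom (qisz p)) (c_mem p F)))
   (c_imp (c_all1 (fun u => c_imp (c_atom (qsing u)) (c_all1 (fun v =>
             c_imp (c_atom (qsing v)) (c_imp (c_not (c_atom (qlt v u)))
            (c_all1 (fun p => c_imp (c_atom (qunion u v p)) (c_imp (c_mem p F)
            (c_all1 (fun u' => c_imp (c_atom (qshift u u')) (c_all1 (fun v' =>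
             c_imp (c_atom (qsing v')) (c_imp (c_plus v a v')
            (c_all1 (fun p' => c_imp (c_atom (qunion u' v' p')) (c_mem p' F))))))))))))))))
          (c_all1 (fun p => c_imp (c_atom (qunion b c p)) (c_mem p F)))))))).

(** The value of a compound term becomes a fresh number variable, quantified existentially around
    the continuation; a variable is passed on as it is. *)
Definition c_term : tree -> (tree -> tree) -> (tree -> cps) -> cps :=
  rose (fun _ k => k Leaf) (fun k args f1 f2 =>
    sw (fun r k => k (r (thd args)))
   (sw (fun r k => f1 r (fun a => f2 r (fun b =>
          c_exn (fun v => c_and (c_plus a b v) (k v)))))
   (fun _ r k => f1 r (fun a => f2 r (fun b =>
          c_exn (fun v => c_and (c_mult a b v) (k v)))))) k).

Definition c_bin (m : tree -> tree -> tree) (r : tree -> tree) (t1 t2 : tree) : cps :=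
  c_term t1 r (fun a => c_term t2 r (fun b => c_atom (m a b))).

Definition c_eq2 (x y : tree) : cps :=
  c_all1 (fun v => c_and (c_imp (c_mem v x) (c_mem v y)) (c_imp (c_mem v y) (c_mem v x))).

Definition c_form : tree -> (tree -> tree) -> (tree -> tree) -> (tree -> tree) -> cps :=
  rose (fun _ _ _ => c_atom Leaf) (fun k args f1 f2 =>
    sw (fun r0 r1 r2 => c_bin qeq r0 (thd args) (tthd args))
   (sw (fun r0 r1 r2 => c_bin qlt r0 (thd args) (tthd args))
   (sw (fun r0 r1 r2 => c_term (thd args) r0 (fun a => c_atom (qsub a (r1 (tthd args)))))
   (sw (fun r0 r1 r2 => c_mem (r1 (thd args)) (r2 (tthd args)))
   (sw (fun r0 r1 r2 => c_atom (qeq (r1 (thd args)) (r1 (tthd args))))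
   (sw (fun r0 r1 r2 => c_eq2 (r2 (thd args)) (r2 (tthd args)))
   (sw (fun r0 r1 r2 => c_not (f1 r0 r1 r2))
   (sw (fun r0 r1 r2 => c_or (f1 r0 r1 r2) (f2 r0 r1 r2))
   (sw (fun r0 r1 r2 => c_exn (fun v => f2 (tupd r0 (thd args) v) r1 r2))
   (sw (fun r0 r1 r2 => c_ex1 (fun v => f2 r0 (tupd r1 (thd args) v) r2))
   (fun _ r0 r1 r2 => c_ex2 (fun v => f2 r0 r1 (tupd r2 (thd args) v)))))))))))) k).

Definition tplus (a b : tree) : tree := trec b (fun _ _ _ r => tS r) a.

(** Any constant that covers the costliest constructor would do; a product spends 23 names, 22 for
    the graph of multiplication and one for the value. *)
Definition bound : tree -> tree :=
  trec Leaf (fun _ _ ra rb => tplus (code_nat 64) (tplus ra rb)).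

(* The part before [c_form] forces every set of numbers to occur as the set of
   positions of proposition 0 in some trace: the values of proposition 1 are
   arbitrary. *)
Definition lower_formula (d : tree) : tree :=
  con2 (code_nat 3) (code_nat 1) (con2 (code_nat 1) (code_nat 1)
    (con2 (code_nat 0) (code_nat 2)
      (c_form d (fun v => v) (fun v => v) (fun v => v) (code_nat 3) Leaf (fun _ m =>
         con1 (code_nat 4) (qand
           (qalw (qiff (qx (code_nat 2)) (qatom (code_nat 1) (code_nat 1)))) m))))).

(** The summand 3 is for the names 0, 1, 2 of the prefix: a proposition and two traces. *)
Definition lower (d : tree) : tree :=
  Node (tplus (code_nat 3) (bound d)) (lower_formula d).

(** * Realizability of the translation into HyperQPTL+ *)

Lemma real_qatom : real qatom. Proof. rewrite /qatom; realize. Qed.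
#[local] Hint Resolve real_qatom : real.
Lemma real_qx : real qx. Proof. rewrite /qx; realize. Qed.
#[local] Hint Resolve real_qx : real.
Lemma real_qneg : real qneg. Proof. rewrite /qneg; realize. Qed.
#[local] Hint Resolve real_qneg : real.
Lemma real_qor : real qor. Proof. rewrite /qor; realize. Qed.
#[local] Hint Resolve real_qor : real.
Lemma real_qnext : real qnext. Proof. rewrite /qnext; realize. Qed.
#[local] Hint Resolve real_qnext : real.
Lemma real_qev : real qev. Proof. rewrite /qev; realize. Qed.
#[local] Hint Resolve real_qev : real.
Lemma real_qand : real qand. Proof. rewrite /qand; realize. Qed.
#[local] Hint Resolve real_qand : real.
Lemma real_qalw : real qalw. Proof. rewrite /qalw; realize. Qed.
#[local] Hint Resolve real_qalw : real.
Lemma real_qiff : real qiff. Proof. rewrite /qiff; realize. Qed.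
#[local] Hint Resolve real_qiff : real.
Lemma real_qsub : real qsub. Proof. rewrite /qsub; realize. Qed.
#[local] Hint Resolve real_qsub : real.
Lemma real_qeq : real qeq. Proof. rewrite /qeq; realize. Qed.
#[local] Hint Resolve real_qeq : real.
Lemma real_qlt : real qlt. Proof. rewrite /qlt; realize. Qed.
#[local] Hint Resolve real_qlt : real.
Lemma real_qzero : real qzero. Proof. rewrite /qzero; realize. Qed.
#[local] Hint Resolve real_qzero : real.
Lemma real_qshift : real qshift. Proof. rewrite /qshift; realize. Qed.
#[local] Hint Resolve real_qshift : real.
Lemma real_qunion : real qunion. Proof. rewrite /qunion; realize. Qed.
#[local] Hint Resolve real_qunion : real.
Lemma real_qzunion : real qzunion. Proof. rewrite /qzunion; realize. Qed.
#[local] Hint Resolve real_qzunion : real.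
Lemma real_qisz : real qisz. Proof. rewrite /qisz; realize. Qed.
#[local] Hint Resolve real_qisz : real.
Lemma real_qsing : real qsing. Proof. rewrite /qsing; realize. Qed.
#[local] Hint Resolve real_qsing : real.
Lemma real_c_atom : real c_atom. Proof. rewrite /c_atom; realize. Qed.
#[local] Hint Resolve real_c_atom : real.
Lemma real_c_not : real c_not. Proof. rewrite /c_not; realize. Qed.
#[local] Hint Resolve real_c_not : real.
Lemma real_c_or : real c_or. Proof. rewrite /c_or; realize. Qed.
#[local] Hint Resolve real_c_or : real.
Lemma real_c_ex1 : real c_ex1. Proof. rewrite /c_ex1; realize. Qed.
#[local] Hint Resolve real_c_ex1 : real.
Lemma real_c_ex2 : real c_ex2. Proof. rewrite /c_ex2; realize. Qed.
#[local] Hint Resolve real_c_ex2 : real.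
Lemma real_c_and : real c_and. Proof. rewrite /c_and; realize. Qed.
#[local] Hint Resolve real_c_and : real.
Lemma real_c_imp : real c_imp. Proof. rewrite /c_imp; realize. Qed.
#[local] Hint Resolve real_c_imp : real.
Lemma real_c_all1 : real c_all1. Proof. rewrite /c_all1; realize. Qed.
#[local] Hint Resolve real_c_all1 : real.
Lemma real_c_all2 : real c_all2. Proof. rewrite /c_all2; realize. Qed.
#[local] Hint Resolve real_c_all2 : real.
Lemma real_c_mem : real c_mem. Proof. rewrite /c_mem; realize. Qed.
#[local] Hint Resolve real_c_mem : real.
Lemma real_c_exn : real c_exn. Proof. rewrite /c_exn; realize. Qed.
#[local] Hint Resolve real_c_exn : real.
Lemma real_c_plus : real c_plus. Proof. rewrite /c_plus; realize. Qed.
#[local] Hint Resolve real_c_plus : real.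
Lemma real_c_mult : real c_mult. Proof. rewrite /c_mult; realize. Qed.
#[local] Hint Resolve real_c_mult : real.
Lemma real_c_term : real c_term. Proof. rewrite /c_term; realize. Qed.
#[local] Hint Resolve real_c_term : real.
Lemma real_c_bin : real c_bin. Proof. rewrite /c_bin; realize. Qed.
#[local] Hint Resolve real_c_bin : real.
Lemma real_c_eq2 : real c_eq2. Proof. rewrite /c_eq2; realize. Qed.
#[local] Hint Resolve real_c_eq2 : real.
Lemma real_c_form : real c_form. Proof. rewrite /c_form; realize. Qed.
#[local] Hint Resolve real_c_form : real.
Lemma real_tplus : real tplus. Proof. rewrite /tplus; realize. Qed.
#[local] Hint Resolve real_tplus : real.
Lemma real_bound : real bound. Proof. rewrite /bound; realize. Qed.
#[local] Hint Resolve real_bound : real.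
Lemma real_lower_formula : real lower_formula. Proof. rewrite /lower_formula; realize. Qed.
#[local] Hint Resolve real_lower_formula : real.
Lemma real_lower : real lower. Proof. rewrite /lower; realize. Qed.
#[local] Hint Resolve real_lower : real.

(** * Unique readability of codes, agreement of assignments, contexts *)

Lemma code_qf_inj n : injective (@code_qf n).
Proof.
elim=> [p x|f IH|f IHf g IHg|f IH|f IH] [p' x'|f'|f' g'|f'|f'] //=; case.
- by move=> /code_nat_inj/val_inj-> /code_nat_inj->.
- by move/IH->.
- by move=> /IHf-> /IHg->.
- by move/IH->.
- by move/IH->.
Qed.

(** That a tree denotes a truth value is expressed by the existence of a formula with that code.
    Under a quantifier this yields one formula for each trace or trace set; injectivity shows that
    they are all the same formula. *)
Lemma code_formula_inj n : injective (@code_formula n).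
Proof.
elim=> [x f IH|x f IH|q f IH|q f IH|m] [x' f'|x' f'|q' f'|q' f'|m'] //=; case.
- by move=> /code_nat_inj-> /IH->.
- by move=> /code_nat_inj-> /IH->.
- by move=> /code_nat_inj/val_inj-> /IH->.
- by move=> /code_nat_inj/val_inj-> /IH->.
- by move/code_qf_inj->.
Qed.

Section Scopes.
Variable AP : finType.
Implicit Types (psi : qf_formula AP) (phi : formula AP) (Pi : assignment AP).

Lemma qf_scoped_sub (s s' : seq nat) psi :
  {subset s <= s'} -> qf_scoped s psi -> qf_scoped s' psi.
Proof.
move=> ss'; elim: psi => //= f IHf g IHg.
by case/andP=> /IHf-> /IHg->.
Qed.

Lemma qf_sat_agree (s : seq nat) Pi Pi' psi i : {in s, Pi =1 Pi'} -> qf_scoped s psi ->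
  qf_sat Pi i psi <-> qf_sat Pi' i psi.
Proof.
move=> eqPi; elim: psi i => /= [p x|f IH|f IHf g IHg|f IH|f IH] i.
- by move=> /eqPi->.
- by move/IH->.
- by case/andP=> /IHf-> /IHg->.
- by move/IH->.
- by move/IH=> {}IH; split=> -[j [ij]]; exists j; split=> //; apply/IH.
Qed.

Lemma qf_sat_and Pi i psi psi' :
  qf_sat Pi i (Neg (Or (Neg psi) (Neg psi'))) <-> qf_sat Pi i psi /\ qf_sat Pi i psi'.
Proof. by rewrite /= not_orP !notK. Qed.

Lemma qf_sat_alw Pi i psi :
  qf_sat Pi i (Neg (Eventually (Neg psi))) <-> forall j, i <= j -> qf_sat Pi j psi.
Proof.
rewrite /= -forallNP; split=> [h j ij|h j [ij]]; last by apply; apply: h.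
by apply: contrapT => nj; apply: (h j).
Qed.

End Scopes.

(** [K] is the truth value of the whole formula as a function of that of the subformula being
    translated; the polarity [true] means that it is antitone. *)
Definition mono (pol : bool) (K : Prop -> Prop) : Prop :=
  forall P Q : Prop, (P -> Q) -> if pol then K Q -> K P else K P -> K Q.

Lemma mono_not pol K : mono pol K -> mono (~~ pol) (fun P => K (~ P)).
Proof. by case: pol => m P Q PQ /=; apply: m => nQ /PQ. Qed.

(** The prenex law: an existential quantifier leaves a monotone context unchanged and an antitone
    one as a universal quantifier. Nonemptiness of the domain serves the case in which no [i]
    satisfies [P]. *)
Lemma mono_ex pol K (I : Type) (D P : I -> Prop) : mono pol K -> (exists i, D i) ->
  (if pol then forall i, D i -> K (P i) else exists i, D i /\ K (P i)) <->
  K (exists i, D i /\ P i).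
Proof.
case: pol => m [i0 Di0]; split.
- move=> h; have [[i [Di Pi]]|ne] := pselect (exists i, D i /\ P i).
    by apply: (m _ _ _ (h i Di)).
  by apply: (m _ _ _ (h i0 Di0)) => /ne.
- by move=> h i Di; apply: (m _ _ _ h) => Pi; exists i.
- by case=> i [Di]; apply: m => Pi; exists i.
- have [[i [Di Pi]]|ne] := pselect (exists i, D i /\ P i).
    by move=> h; exists i; split=> //; apply: (m _ _ _ h).
  by move=> h; exists i0; split=> //; apply: (m _ _ _ h) => /ne.
Qed.

(** * Semantics of the prenex translation over a family of sets *)

Section LowerSemantics.
Variable N : nat.
Notation AP := 'I_N.+1.
Implicit Types (Pi : assignment AP) (T : set (trace AP)).

Definition xset (t : trace AP) : set nat := [set i | ord0 \in t i].

Definition xs Pi (v : nat) : set nat :=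
  [set i | if Pi v is Some t then ord0 \in t i else False].

Definition mark T (v : nat) : set (set nat) :=
  [set A | exists t, [/\ T t, xset t = A & inord v.+1 \in t 0]].

(* [ss] lists the names of trace variables among the names below [sc]. *)
Record state := State {
  sc : nat;
  ss : seq nat;
  sT : set (trace AP);
  sPi : assignment AP
}.

(* The set quantifiers of the translation range over the sets [U] given by
   proposition 0 in the traces, which need not be all sets. *)
Variable U : set (set nat).

Definition valid (s : state) : Prop :=
  [/\ exists t, sT s t, forall v, v \in ss s -> v < sc s
    & forall A, U A <-> exists t, sT s t /\ xset t = A].

(** The trace sets of the two states need not be comparable: only the families marked by names
    already in use persist, and, through [valid], the family [U]. *)
Definition ext (s s' : state) : Prop :=
  [/\ sc s <= sc s', {subset ss s <= ss s'} /\ {in ss s, sPi s' =1 sPi s},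
      forall v, v < sc s -> mark (sT s') v = mark (sT s) v & valid s'].

Definition den1 (s : state) (v : nat) (A : set nat) : Prop :=
  v \in ss s /\ xs (sPi s) v = A.

Definition den2 (s : state) (v : nat) (Y : set (set nat)) : Prop :=
  v < sc s /\ mark (sT s) v = Y.

Definition qden (s : state) (m : tree) (B : Prop) : Prop :=
  exists psi : qf_formula AP,
    [/\ code_qf psi = m, qf_scoped (ss s) psi & qf_sat (sPi s) 0 psi <-> B].

Definition tden (s : state) (d : tree) (B : Prop) : Prop :=
  exists phi : formula AP,
    [/\ code_formula phi = d, scoped (ss s) phi
      & sat (sT s) (sPi s) 0 phi <-> B].

(* [w] bounds the number of names used. *)
Definition spec (w : nat) (s : state) (D : cps) (P : Prop) : Prop :=
  forall s', ext s s' -> sc s' + w <= N -> forall pol K k, mono pol K ->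
  (forall s'' m B, ext s' s'' -> sc s'' <= sc s' + w -> qden s'' m B ->
     tden s'' (k (code_nat (sc s'')) m) (K B)) ->
  tden s' (D (code_nat (sc s')) (code_nat pol) k) (K P).

Lemma ext_refl s : valid s -> ext s s. Proof. by move=> va; split=> //; split. Qed.

Lemma ext_valid s s' : ext s s' -> valid s'. Proof. by case. Qed.

Lemma ext_trans s s' s'' : ext s s' -> ext s' s'' -> ext s s''.
Proof.
move=> [le [sub Pi_] m_ _] [le' [sub' Pi'_] m'_ va]; split=> // [||v lt].
- exact: leq_trans le'.
- by split=> v sv; [apply/sub'/sub | rewrite Pi'_ ?Pi_ //; apply: sub].
- by rewrite m'_ ?m_ //; apply: leq_trans le.
Qed.

Lemma den1_ext s s' v A : ext s s' -> den1 s v A -> den1 s' v A.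
Proof.
move=> [_ [sub Pi_] _ _] [sv <-]; split; first exact: sub.
by rewrite /xs Pi_.
Qed.

Lemma den2_ext s s' v Y : ext s s' -> den2 s v Y -> den2 s' v Y.
Proof. by move=> [le _ m_ _] [lt <-]; split; [exact: leq_trans le | apply: m_]. Qed.

Lemma qden_ext s s' m B : ext s s' -> qden s m B -> qden s' m B.
Proof.
move=> [_ [sub Pi_] _ _] [psi [cm sm /propext<-]]; exists psi; split=> //.
  exact: qf_scoped_sub sm.
exact: (@qf_sat_agree _ (ss s)).
Qed.

Lemma qden_iff s m B B' : (B <-> B') -> qden s m B -> qden s m B'.
Proof. by move/propext->. Qed.

Definition qfun (s : state) (m : tree) (B : nat -> Prop) : Prop :=
  exists psi : qf_formula AP, [/\ code_qf psi = m, qf_scoped (ss s) psi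
    & forall i, qf_sat (sPi s) i psi <-> B i].

Lemma qden_qfun s m B : qfun s m B -> qden s m (B 0).
Proof. by case=> psi [c sc_ h]; exists psi; split. Qed.

Lemma qfun_x s v A : den1 s v A -> qfun s (qx (code_nat v)) A.
Proof. by case=> sv <-; exists (Atom ord0 v); split. Qed.

Lemma qfun_neg s m B : qfun s m B -> qfun s (qneg m) (fun i => ~ B i).
Proof. by case=> psi [<- sm h]; exists (Neg psi); split=> //= i; rewrite h. Qed.

Lemma qfun_or s m m' B B' : qfun s m B -> qfun s m' B' ->
  qfun s (qor m m') (fun i => B i \/ B' i).
Proof.
move=> [psi [<- sm h]] [psi' [<- sm' h']]; exists (Or psi psi').
by split=> //= [|i]; rewrite ?sm ?h ?h'.
Qed.

Lemma qfun_and s m m' B B' : qfun s m B -> qfun s m' B' ->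
  qfun s (qand m m') (fun i => B i /\ B' i).
Proof.
move=> [psi [<- sm h]] [psi' [<- sm' h']]; exists (Neg (Or (Neg psi) (Neg psi'))).
by split=> // [|i]; rewrite ?qf_sat_and /= ?sm ?h ?h'.
Qed.

Lemma qfun_next s m B : qfun s m B -> qfun s (qnext m) (fun i => B i.+1).
Proof. by case=> psi [<- sm h]; exists (Next psi); split=> //= i; rewrite h. Qed.

Lemma qfun_ev s m B : qfun s m B -> qfun s (qev m) (fun i => exists j, i <= j /\ B j).
Proof.
case=> psi [<- sm h]; exists (Eventually psi); split=> //= i.
by split=> -[j [ij /h hj]]; exists j.
Qed.

Lemma qfun_alw s m B : qfun s m B -> qfun s (qalw m) (fun i => forall j, i <= j -> B j).
Proof.
case=> psi [<- sm h]; exists (Neg (Eventually (Neg psi))); split=> // i.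
by rewrite qf_sat_alw; split=> hj j /hj /h.
Qed.

Lemma qfun_iff s m m' B B' : qfun s m B -> qfun s m' B' ->
  qfun s (qiff m m') (fun i => B i <-> B' i).
Proof.
move=> h h'; have [psi [c sm sP]] :=
  qfun_or (qfun_and h h') (qfun_and (qfun_neg h) (qfun_neg h')).
exists psi; split=> // i; rewrite sP; split=> [[[b b']|[b b']]//|[b b']].
by have [/[dup]/b|nb] := pselect (B i); [left|right; split=> // /b'].
Qed.

Lemma qden_neg s m B : qden s m B -> qden s (qneg m) (~ B).
Proof. by case=> psi [<- sm satP]; exists (Neg psi); split=> //=; rewrite satP. Qed.

Lemma qden_or s m m' B B' : qden s m B -> qden s m' B' -> qden s (qor m m') (B \/ B').
Proof.
move=> [psi [<- sm satP]] [psi' [<- sm' satP']]; exists (Or psi psi').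
by split=> //=; rewrite ?sm ?satP ?satP'.
Qed.

Lemma spec_iff w s D P P' : (P <-> P') -> spec w s D P -> spec w s D P'.
Proof. by move/propext->. Qed.

Lemma spec_le w w' s D P : w <= w' -> spec w s D P -> spec w' s D P.
Proof.
move=> le DP s' e lt pol K k mK kP; apply: DP => //; first by lia.
by move=> s'' m B e' le'; apply: kP => //; lia.
Qed.

Lemma spec_atom s m P :
  (forall s', ext s s' -> sc s' <= N -> qden s' m P) -> spec 0 s (c_atom m) P.
Proof.
move=> mP s' e lt pol K k mK; apply; [apply/ext_refl/(ext_valid e) | lia |].
by apply: mP => //; lia.
Qed.

Lemma spec_not w s D P : spec w s D P -> spec w s (c_not D) (~ P).
Proof.
move=> DP s' e lt pol K k mK kP; rewrite /c_not.
have -> : tif (code_nat pol) Leaf (code_nat 1) = code_nat (~~ pol) by case: (pol).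
apply: (DP s' e lt (~~ pol) (fun P => K (~ P))); first exact: mono_not.
by move=> s'' m B e' le mB; apply: kP => //; apply: qden_neg.
Qed.

Lemma spec_or w1 w2 s D1 D2 P1 P2 : spec w1 s D1 P1 -> spec w2 s D2 P2 ->
  spec (w1 + w2) s (c_or D1 D2) (P1 \/ P2).
Proof.
move=> DP1 DP2 s' e lt pol K k mK kP; rewrite /c_or.
(* While the first disjunct is being translated the second one is still the abstract [P2];
   afterwards the first is the truth value [B1] of its quantifier-free part, all quantifiers having
   been emitted. *)
apply: (DP1 s' e _ pol (fun P => K (P \/ P2))); first by lia.
  by move=> P Q PQ; apply: mK => -[/PQ|]; [left|right].
move=> s1 m1 B1 e1 le1 mB1.
apply: (DP2 s1 (ext_trans e e1) _ pol (fun P => K (B1 \/ P))); first by lia.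
  by move=> P Q PQ; apply: mK => -[|/PQ]; [left|right].
move=> s2 m2 B2 e2 le2 mB2; apply: kP; first exact: ext_trans e2.
  by lia.
by apply: qden_or => //; apply: qden_ext mB1.
Qed.

Lemma spec_and w1 w2 s D1 D2 P1 P2 : spec w1 s D1 P1 -> spec w2 s D2 P2 ->
  spec (w1 + w2) s (c_and D1 D2) (P1 /\ P2).
Proof.
move=> h1 h2; apply: (@spec_iff _ _ _ (~ (~ P1 \/ ~ P2))); last first.
  by apply/spec_not/spec_or; apply: spec_not.
by rewrite not_orP !notK.
Qed.

Lemma spec_imp w1 w2 s D1 D2 (P1 P2 : Prop) : spec w1 s D1 P1 -> spec w2 s D2 P2 ->
  spec (w1 + w2) s (c_imp D1 D2) (P1 -> P2).
Proof.
move=> h1 h2; apply: (@spec_iff _ _ _ (~ P1 \/ P2)).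
  by rewrite implyE.
by apply: spec_or => //; apply: spec_not.
Qed.

Definition push1 (s : state) (t : trace AP) : state :=
  State (sc s).+1 (sc s :: ss s) (sT s) (update (sPi s) (sc s) (Some t)).

Definition push2 (s : state) T : state := State (sc s).+1 (ss s) T (sPi s).

Lemma ext_push1 s t : valid s -> ext s (push1 s t).
Proof.
move=> [ne lt UP]; split=> //=; first split.
- by move=> v sv; rewrite inE sv orbT.
- by move=> v /lt ltv; rewrite /update ltn_eqF.
- by split=> //= v; rewrite inE => /orP[/eqP->|/lt/ltnW].
Qed.

Lemma den1_push1 s t : den1 (push1 s t) (sc s) (xset t).
Proof. by split=> /=; rewrite ?inE /xs /update eqxx. Qed.

Lemma ord0_neq_inord v : v.+1 <= N -> (ord0 : AP) != inord v.+1.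
Proof. by move=> le; rewrite -val_eqE /= inordK. Qed.

Lemma eq_on_sym (A : {set AP}) T T' : eq_on A T T' -> eq_on A T' T.
Proof. exact: esym. Qed.

Lemma eq_onP (q : AP) T T' t : eq_on [set~ q]%SET T T' -> T t ->
  exists2 t', T' t' & forall p i, p != q -> (p \in t' i) = (p \in t i).
Proof.
move=> eqT Tt; have : (proj [set~ q]%SET @` T') (proj [set~ q]%SET t).
  by rewrite -eqT; exists t.
case=> t' Tt' eqt; exists t' => // p i pq.
have /setP/(_ p) : proj [set~ q]%SET t' i = proj [set~ q]%SET t i by rewrite eqt.
by rewrite !inE pq !andbT.
Qed.

Lemma eq_on_xset (q : AP) T T' t : ord0 != q -> eq_on [set~ q]%SET T T' -> T t ->
  exists2 t', T' t' & xset t' = xset t.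
Proof.
move=> q0 eqT Tt; have [t' Tt' tt'] := eq_onP eqT Tt; exists t' => //.
by apply/seteqP; split=> i; rewrite /xset /= tt'.
Qed.

(** The requantified proposition is neither 0 nor one of the earlier names, so the sets shown by
    traces and the earlier marks are unaffected. *)
Lemma ext_push2 s T : valid s -> sc s < N ->
  eq_on [set~ inord (sc s).+1]%SET (sT s) T -> ext s (push2 s T).
Proof.
move=> [[t0 Tt0] ssP UP] lt eqT; have q0 := ord0_neq_inord lt.
split=> //= [|v ltv|]; [by split | |].
  have neq : (inord v.+1 : AP) != inord (sc s).+1.
    by rewrite -val_eqE /= !inordK //; lia.
  apply/seteqP; split=> A [t [Tt <- mt]].
    have [t' Tt' tt'] := eq_onP (eq_on_sym eqT) Tt; exists t'; split; rewrite ?tt' //.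
    by apply/seteqP; split=> i; rewrite /xset /= tt'.
  have [t' Tt' tt'] := eq_onP eqT Tt; exists t'; split; rewrite ?tt' //.
  by apply/seteqP; split=> i; rewrite /xset /= tt'.
split=> [|v /= /ssP/ltnW //|A]; first by have [t' Tt' _] := eq_onP eqT Tt0; exists t'.
rewrite UP /=; split=> -[t [Tt <-]].
  by have [t' Tt' <-] := eq_on_xset q0 eqT Tt; exists t'.
by have [t' Tt' <-] := eq_on_xset q0 (eq_on_sym eqT) Tt; exists t'.
Qed.

Lemma mark_sub s T : valid s -> sc s < N ->
  eq_on [set~ inord (sc s).+1]%SET (sT s) T -> mark T (sc s) `<=` U.
Proof.
move=> va lt eqT A [t [Tt <- _]]; have [_ _ _ [_ _ UP]] := ext_push2 va lt eqT.
by apply/UP; exists t.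
Qed.

(** The variant puts the proposition at position 0 of the traces whose set is in [Y], and nowhere
    else; each member of [Y] is shown by some trace because it is in [U]. *)
Lemma mark_onto s (Y : set (set nat)) : valid s -> sc s < N -> Y `<=` U ->
  exists T, eq_on [set~ inord (sc s).+1]%SET (sT s) T /\ mark T (sc s) = Y.
Proof.
move=> [_ _ UP] lt YU; have q0 := ord0_neq_inord lt; set q := inord _ in q0 *.
pose f (t : trace AP) : trace AP := fun i =>
  if `[< i = 0 /\ Y (xset t) >] then (q |: t i)%SET else (t i :\ q)%SET.
have fE t i p : p != q -> (p \in f t i) = (p \in t i).
  by rewrite /f; case: asboolP => _; rewrite !inE => /negbTE->.
have xf t : xset (f t) = xset t by apply/seteqP; split=> i; rewrite /xset /= fE.
have qf t : q \in f t 0 <-> Y (xset t).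
  rewrite /f; case: asboolP => [[_ h]|h]; first by rewrite !inE eqxx.
  by rewrite !inE eqxx /=; split=> // h'; case: h.
have pf t : proj [set~ q]%SET (f t) = proj [set~ q]%SET t.
  apply/funext => i; apply/setP => p; rewrite !inE.
  by case: (altP (p =P q)) => [_|pq]; rewrite ?andbF ?fE.
exists (f @` sT s); split.
  apply/seteqP; split=> u [t Tt <-]; first by exists (f t); [exists t | rewrite pf].
  by case: Tt => t' Tt' <-; exists t'; rewrite ?pf.
apply/seteqP; split=> [A [t [[t' Tt' <-] <-]]|A YA]; first by rewrite -/q xf => /qf.
have [t [Tt tA]] := (UP A).1 (YU _ YA).
exists (f t); split; [by exists t | by rewrite xf | by apply/qf; rewrite tA].
Qed.

Lemma tden_trace (pol : bool) s d (B : trace AP -> Prop) : valid s ->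
  (forall t, sT s t -> tden (push1 s t) d (B t)) ->
  tden s (con2 (code_nat pol) (code_nat (sc s)) d)
    (if pol then forall t, sT s t -> B t else exists t, sT s t /\ B t).
Proof.
(* Any trace serves to read off the formula, since its code [d] is the same for all of them. *)
move=> [[t0 Tt0] _ _] dB; have [phi [cphi sphi _]] := dB _ Tt0.
have satP t : sT s t -> sat (sT s) (update (sPi s) (sc s) (Some t)) 0 phi <-> B t.
  by case/dB=> phi' [cphi' _]; rewrite -cphi in cphi'; rewrite (code_formula_inj cphi').
exists ((if pol then @AllTrace _ else @ExTrace _) (sc s) phi).
case: pol; split=> //=; rewrite /con2 ?cphi //.
  by split=> h t Tt; apply/satP => //; apply: h.
by split=> -[t [Tt h]]; exists t; split=> //; apply/satP.
Qed.

Lemma tden_prop (pol : bool) s d (B : set (trace AP) -> Prop) : sc s < N ->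
  (forall T, eq_on [set~ inord (sc s).+1]%SET (sT s) T -> tden (push2 s T) d (B T)) ->
  tden s (con2 (tS (tS (code_nat pol))) (tS (code_nat (sc s))) d)
    (if pol then forall T, eq_on [set~ inord (sc s).+1]%SET (sT s) T -> B T
     else exists T, eq_on [set~ inord (sc s).+1]%SET (sT s) T /\ B T).
Proof.
move=> lt dB; have [phi [cphi sphi _]] := dB (sT s) erefl.
have satP T : eq_on [set~ inord (sc s).+1]%SET (sT s) T -> sat T (sPi s) 0 phi <-> B T.
  by case/dB=> phi' [cphi' _]; rewrite -cphi in cphi'; rewrite (code_formula_inj cphi').
exists ((if pol then @AllProp _ else @ExProp _) (inord (sc s).+1) phi).
case: pol; split=> //=; rewrite /con2 ?inordK ?cphi //.
  by split=> h T eqT; apply/satP => //; apply: h.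
by split=> -[T [eqT h]]; exists T; split=> //; apply/satP.
Qed.

Lemma tden_iff s d B B' : (B <-> B') -> tden s d B -> tden s d B'.
Proof. by move/propext->. Qed.

(** The property concerns traces rather than sets because membership also looks at the marks. *)
Lemma spec_trace w s D (Q : Prop) (P : trace AP -> Prop) :
  (forall s', ext s s' -> (exists t, sT s' t /\ P t) <-> Q) ->
  (forall s' t, ext s s' -> sT s' t ->
     spec w (push1 s' t) (D (code_nat (sc s'))) (P t)) ->
  spec w.+1 s (c_ex1 D) Q.
Proof.
move=> PQ DP s' e lt pol K k mK kP; have va := ext_valid e; have [ne _ UP] := va.
rewrite -(propext (PQ _ e)); apply: tden_iff (mono_ex P mK ne) _.
apply: tden_trace => // t Tt; have et := ext_push1 t va.
apply: (DP s' t e Tt (push1 s' t)) => //=.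
- exact: ext_refl (ext_valid et).
- by move: lt; rewrite addSnnS.
- by move=> s'' m B e' le; apply: kP; [exact: ext_trans e' | rewrite -addSnnS].
Qed.

Lemma spec_ex1 w s D (P : set nat -> Prop) :
  (forall s' v A, ext s s' -> U A -> den1 s' v A -> spec w s' (D (code_nat v)) (P A)) ->
  spec w.+1 s (c_ex1 D) (exists A, U A /\ P A).
Proof.
move=> DP; apply: (@spec_trace _ _ _ _ (fun t => P (xset t))).
  move=> s' [_ _ _ [_ _ UP]].
  split=> [[t [Tt PA]]|[A [/UP[t [Tt <-]] PA]]]; last by exists t.
  by exists (xset t); split=> //; apply/UP; exists t.
move=> s' t e Tt; have va := ext_valid e; have [_ _ UP] := va.
apply: DP; [exact: ext_trans (ext_push1 t va) | by apply/UP; exists t | exact: den1_push1].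
Qed.

(** The quantifier is relativized to subfamilies of [U]: by [mark_sub] and [mark_onto] these are
    exactly the families that the variants of the trace set can mark. *)
Lemma spec_ex2 w s D (P : set (set nat) -> Prop) :
  (forall s' v Y, ext s s' -> Y `<=` U -> den2 s' v Y -> spec w s' (D (code_nat v)) (P Y)) ->
  spec w.+1 s (c_ex2 D) (exists Y, Y `<=` U /\ P Y).
Proof.
move=> DP s' e lt pol K k mK kP; have va := ext_valid e.
have ltc : sc s' < N by lia.
have -> : (exists Y, Y `<=` U /\ P Y) =
    exists T, eq_on [set~ inord (sc s').+1]%SET (sT s') T /\ P (mark T (sc s')).
  apply/propext; split=> [[Y [YU PY]]|[T [eqT PT]]]; last first.
    by exists (mark T (sc s')); split=> //; apply: mark_sub eqT.
  by have [T [eqT mT]] := mark_onto va ltc YU; exists T; rewrite mT.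
apply: tden_iff (mono_ex (fun T => P (mark T (sc s'))) mK _) _.
  by exists (sT s').
apply: tden_prop => // T eqT; have et := ext_push2 va ltc eqT.
apply: (DP (push2 s' T) (sc s') (mark T (sc s')) _ _ _ (push2 s' T)) => //=.
- exact: ext_trans et.
- exact: mark_sub eqT.
- exact: ext_refl (ext_valid et).
- by move: lt; rewrite addSnnS.
- by move=> s'' m B e' le; apply: kP; [exact: ext_trans e' | rewrite -addSnnS].
Qed.

Lemma spec_all1 w s D (P : set nat -> Prop) :
  (forall s' v A, ext s s' -> U A -> den1 s' v A -> spec w s' (D (code_nat v)) (P A)) ->
  spec w.+1 s (c_all1 D) (forall A, U A -> P A).
Proof.
move=> DP; apply: (@spec_iff _ _ _ (~ exists A, U A /\ ~ P A)).
  rewrite -forallNP; split=> h A; last by case=> UA; apply; apply: h.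
  by move=> UA; apply: contrapT => nP; apply: (h A).
by apply/spec_not/spec_ex1 => s' v A e UA d; apply/spec_not/DP.
Qed.

Lemma spec_all2 w s D (P : set (set nat) -> Prop) :
  (forall s' v Y, ext s s' -> Y `<=` U -> den2 s' v Y -> spec w s' (D (code_nat v)) (P Y)) ->
  spec w.+1 s (c_all2 D) (forall Y, Y `<=` U -> P Y).
Proof.
move=> DP; apply: (@spec_iff _ _ _ (~ exists Y, Y `<=` U /\ ~ P Y)).
  rewrite -forallNP; split=> h A; last by case=> UA; apply; apply: h.
  by move=> UA; apply: contrapT => nP; apply: (h A).
by apply/spec_not/spec_ex2 => s' v A e UA d; apply/spec_not/DP.
Qed.

Lemma qden_sub s a b A B : den1 s a A -> den1 s b B ->
  qden s (qsub (code_nat a) (code_nat b)) (A `<=` B).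
Proof.
move=> /qfun_x ha /qfun_x hb.
apply: qden_iff (qden_qfun (qfun_alw (qfun_or (qfun_neg ha) hb))).
by split=> h j; [case: (h j) | have [/h|] := pselect (A j); [right|left]].
Qed.

Lemma qden_eq s a b A B : den1 s a A -> den1 s b B ->
  qden s (qeq (code_nat a) (code_nat b)) (A = B).
Proof.
move=> /qfun_x ha /qfun_x hb.
apply: qden_iff (qden_qfun (qfun_alw (qfun_iff ha hb))).
by split=> [h|->//]; apply/seteqP; split=> j; apply h.
Qed.

(** This relation and the following ones are the literal meanings of the temporal formulas for
    arbitrary sets; those that stand for arithmetic do so only on singletons. *)
Definition Rlt (A B : set nat) : Prop := exists i, A i /\ exists j, i < j /\ B j.

Lemma qden_lt s a b A B : den1 s a A -> den1 s b B ->
  qden s (qlt (code_nat a) (code_nat b)) (Rlt A B).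
Proof.
move=> /qfun_x ha /qfun_x hb.
apply: qden_iff (qden_qfun (qfun_ev (qfun_and ha (qfun_next (qfun_ev hb))))).
by split=> -[i]; [case=> _ h|move=> h]; exists i.
Qed.

Definition Rzero (A : set nat) : Prop := A 0.

Lemma qden_zero s a A : den1 s a A -> qden s (qzero (code_nat a)) (Rzero A).
Proof. by move/qfun_x/qden_qfun. Qed.

Definition Rshift (A B : set nat) : Prop := ~ B 0 /\ forall i, A i <-> B i.+1.

Lemma qden_shift s a b A B : den1 s a A -> den1 s b B ->
  qden s (qshift (code_nat a) (code_nat b)) (Rshift A B).
Proof.
move=> /qfun_x ha /qfun_x hb.
apply: qden_iff (qden_qfun (qfun_and (qfun_neg hb) (qfun_alw (qfun_iff ha (qfun_next hb))))).
by split=> -[b0 h]; split=> // i *; exact: h.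
Qed.

Definition Runion (A B P : set nat) : Prop := forall i, P i <-> A i \/ B i.

Lemma qden_union s a b p A B P : den1 s a A -> den1 s b B -> den1 s p P ->
  qden s (qunion (code_nat a) (code_nat b) (code_nat p)) (Runion A B P).
Proof.
move=> /qfun_x ha /qfun_x hb /qfun_x hp.
apply: qden_iff (qden_qfun (qfun_alw (qfun_iff hp (qfun_or ha hb)))).
by split=> h i *; exact: h.
Qed.

Definition Rzunion (A P : set nat) : Prop := P 0 /\ forall i, P i.+1 <-> A i.+1.

Lemma qden_zunion s a p A P : den1 s a A -> den1 s p P ->
  qden s (qzunion (code_nat a) (code_nat p)) (Rzunion A P).
Proof.
move=> /qfun_x ha /qfun_x hp.
apply: qden_iff (qden_qfun (qfun_and hp (qfun_next (qfun_alw (qfun_iff hp ha))))).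
by split=> -[p0 h]; split=> //; [move=> i | case=> // i _]; exact: h.
Qed.

Definition Risz (P : set nat) : Prop := P 0 /\ forall i, ~ P i.+1.

Lemma qden_isz s p P : den1 s p P -> qden s (qisz (code_nat p)) (Risz P).
Proof.
move=> /qfun_x hp.
apply: qden_iff (qden_qfun (qfun_and hp (qfun_next (qfun_alw (qfun_neg hp))))).
by split=> -[p0 h]; split=> //; [move=> i | case=> // i _]; exact: h.
Qed.

Lemma qden_sing s a A : den1 s a A -> qden s (qsing (code_nat a)) (exists n, A = [set n]).
Proof.
move=> /qfun_x ha.
apply: qden_iff (qden_qfun (qfun_and (qfun_ev ha)
  (qfun_alw (qfun_or (qfun_neg ha) (qfun_next (qfun_alw (qfun_neg ha))))))).
split=> [[[n [_ An]] h]|[n ->]].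
  exists n; apply/seteqP; split=> [m Am|_ ->] //=.
  have [lt|lt|//] := ltngtP n m; first by case: (h n) => // /(_ m lt).
  by case: (h m) => // /(_ n lt).
split=> [|j _]; first by exists n.
have [->|nj] := pselect (j = n); [right=> i lt /= eqi | by left].
by rewrite eqi ltnn in lt.
Qed.

Lemma spec_mem s x y X Y : den1 s x X -> den2 s y Y ->
  spec 1 s (c_mem (code_nat x) (code_nat y)) (Y X).
Proof.
move=> dx dy.
apply: (@spec_trace _ _ _ _ (fun t => xset t = X /\ inord y.+1 \in t 0)).
  move=> s' e; have [_ <-] := den2_ext e dy.
  by split=> [[t [Tt [<- h]]]|[t [Tt <- h]]]; exists t.
move=> s' t e Tt; set v := sc s'; apply: spec_atom => s'' e' le.
have es' := ext_push1 t (ext_valid e).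
have hv := qfun_x (den1_ext e' (den1_push1 s' t)).
have hx := qfun_x (den1_ext (ext_trans e (ext_trans es' e')) dx).
have [lty _] := den2_ext (ext_trans e (ext_trans es' e')) dy.
have hm : qfun s'' (qatom (tS (code_nat y)) (code_nat v)) (fun i => inord y.+1 \in t i).
  have [_ [sub Pi_] _ _] := e'.
  have sv : v \in ss (push1 s' t) by rewrite inE eqxx.
  exists (Atom (inord y.+1) v); split=> [||i] /=.
  - by rewrite inordK //; lia.
  - exact: sub.
  - by rewrite Pi_ //= /update eqxx.
apply: qden_iff (qden_qfun (qfun_and (qfun_alw (qfun_iff hv hx)) hm)).
split=> -[h ?]; split=> //; last by rewrite h.
by apply/seteqP; split=> j; apply h.
Qed.

End LowerSemantics.

(** * The meaning of translated sentences relative to [U], and its collapse to arithmetic when [U]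
    is full *)

Section Meaning.
Variable U : set (set nat).

Definition Rplus (A B C : set nat) : Prop :=
  ~ Rlt C B /\
  forall F, F `<=` U ->
    (forall p, U p -> Rzunion A p -> F p) ->
    (forall p, U p -> forall p', U p' -> Rshift p p' -> F p -> F p') ->
    forall p, U p -> Runion B C p -> F p.

Definition Rmult (A B C : set nat) : Prop :=
  Rzero A /\ Rzero C \/
  ~ Rzero A /\ ~ Rlt C B /\
  forall F, F `<=` U ->
    (forall p, U p -> Risz p -> F p) ->
    (forall u, U u -> (exists n, u = [set n]) -> forall v, U v -> (exists n, v = [set n]) ->
       ~ Rlt v u -> forall p, U p -> Runion u v p -> F p ->
       forall u', U u' -> Rshift u u' -> forall v', U v' -> (exists n, v' = [set n]) ->
       Rplus v A v' -> forall p', U p' -> Runion u' v' p' -> F p') ->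
    forall p, U p -> Runion B C p -> F p.

Definition Rexn (P : set nat -> Prop) : Prop :=
  exists A, U A /\ (exists n, A = [set n]) /\ P A.

Fixpoint Rterm (e : nat -> set nat) (t : aterm) (P : set nat -> Prop) : Prop :=
  match t with
  | AVar x => P (e x)
  | APlus t1 t2 => Rterm e t1 (fun A => Rterm e t2 (fun B =>
      Rexn (fun C => Rplus A B C /\ P C)))
  | AMult t1 t2 => Rterm e t1 (fun A => Rterm e t2 (fun B =>
      Rexn (fun C => Rmult A B C /\ P C)))
  end.

Fixpoint Rform (e0 e1 : nat -> set nat) (e2 : nat -> set (set nat)) (phi : aformula) :
    Prop :=
  match phi with
  | AEq t1 t2 => Rterm e0 t1 (fun A => Rterm e0 t2 (fun B => A = B))
  | ALt t1 t2 => Rterm e0 t1 (fun A => Rterm e0 t2 (fun B => Rlt A B))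
  | AMem1 t x => Rterm e0 t (fun A => A `<=` e1 x)
  | AMem2 x y => e2 y (e1 x)
  | AEq1 x y => e1 x = e1 y
  | AEq2 x y => forall A, U A -> (e2 x A -> e2 y A) /\ (e2 y A -> e2 x A)
  | ANot phi1 => ~ Rform e0 e1 e2 phi1
  | AOr phi1 phi2 => Rform e0 e1 e2 phi1 \/ Rform e0 e1 e2 phi2
  | AEx0 x phi1 => Rexn (fun A => Rform (update e0 x A) e1 e2 phi1)
  | AEx1 x phi1 => exists A, U A /\ Rform e0 (update e1 x A) e2 phi1
  | AEx2 x phi1 => exists Y, Y `<=` U /\ Rform e0 e1 (update e2 x Y) phi1
  end.

Hypothesis U_full : forall A, U A.

Lemma Rlt_set1 a b : Rlt [set a] [set b] <-> a < b.
Proof.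
split=> [[i [ia [j [lt jb]]]]|lt]; first by rewrite -[a]ia -[b]jb.
by exists a; split=> //; exists b.
Qed.

Lemma Rplus_set1 a b c : Rplus [set a] [set b] [set c] <-> a + b = c.
Proof.
rewrite /Rplus Rlt_set1; split=> [[nlt h]|abc].
  (* The hypothesis is applied to the least such family, the sets [{i, a + i}]; as [b <= c], the
     equality of [{b, c}] with one of them gives [b = i] and [c = a + i]. *)
  have [i hi] : [set P | exists i, Runion [set i] [set a + i] P] [set i | i = b \/ i = c].
    apply: h => //.
    - by move=> p _ [p0 hp]; exists 0 => -[|i] /=; [split=> // _; left | rewrite hp /=; lia].
    - move=> p _ p' _ [p0 hp] [i hi]; exists i.+1 => -[|j] /=; first by split=> [/p0 //|]; lia.
    by rewrite -hp hi /=; lia.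
  by have := hi b; have := hi c; have := hi i; have := hi (a + i); rewrite /=; lia.
split=> [|F FU h0 hS]; first lia.
suff hF i p : Runion [set i] [set a + i] p -> F p by move=> p _ hp; apply: (hF b); rewrite abc.
elim: i p => [|i IH] p hp.
  by apply: h0 => //; split=> [|i]; rewrite hp /=; [left|lia].
apply: (hS [set j | j = i \/ j = a + i]) => //; last exact: IH.
by split=> [|j]; rewrite hp /=; lia.
Qed.

(** As for addition, with the least family consisting of the sets [{i, a * i}]. Decoding by order
    relies on [i <= a * i], which fails for [a = 0]; this is why that case has a disjunct of its
    own. *)
Lemma Rmult_set1 a b c : Rmult [set a] [set b] [set c] <-> a * b = c.
Proof.
rewrite /Rmult /Rzero Rlt_set1 /=; have [->|a0] := posnP a.
  by rewrite mul0n; split=> [[[]|[]]|<-] //; left.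
split=> [[[a_ _]|[_ [nlt h]]]|abc]; first by rewrite -a_ in a0.
  have [i hi] : [set P | exists i, Runion [set i] [set a * i] P] [set i | i = b \/ i = c].
    apply: h => //.
    - by move=> p _ [p0 hp]; exists 0 => -[|i] /=; rewrite ?muln0; split=> //; [left|move/hp|case].
    - move=> _ _ [u ->] _ _ [v ->]; rewrite Rlt_set1 => uv p _ hp [i hi].
    move=> u' _ [u0 hu] _ _ [v' ->] /Rplus_set1 vv p' _ hp'; exists i.+1 => j.
    (* Both pairs are listed in increasing order, so equal sets have equal components. *)
    have uE : u = i /\ v = a * i.
      have := hi u; have := hi v; have := hi i; have := hi (a * i); rewrite !hp /=; nia.
    rewrite hp' /= -vv uE.2 mulnS [a + _]addnC.
    by case: j => [|j]; [split=> [[/u0 //|]|]; lia | rewrite -hu /= uE.1; lia].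
  by have := hi b; have := hi c; have := hi i; have := hi (a * i); rewrite /=; nia.
right; split; first by move=> a_; rewrite -a_ in a0.
split=> [|F FU h0 hS]; first nia.
suff hF i p : Runion [set i] [set a * i] p -> F p by move=> p _ hp; apply: (hF b); rewrite abc.
elim: i p => [|i IH] p hp.
  by apply: h0 => //; split=> [|i]; rewrite hp /= ?muln0; [left|case].
apply: (hS [set i] _ _ [set a * i] _ _ _ [set j | j = i \/ j = a * i] _ _ _
           [set i.+1] _ _ [set a * i.+1]) => //.
- by exists i.
- by exists (a * i).
- by rewrite Rlt_set1; nia.
- exact: IH.
- by split=> [|j] /=; [|split=> [->|[]]].
- by exists (a * i.+1).
- by apply/Rplus_set1; rewrite mulnS addnC.
Qed.

Lemma Rexn_full P : Rexn P <-> exists n, P [set n].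
Proof.
split=> [[A [_ [[n An] Pn]]]|[n Pn]]; first by exists n; rewrite -An.
by exists [set n]; split=> //; split=> //; exists n.
Qed.

Lemma Rterm_full e t P : Rterm (fun x => [set e x]) t P <-> P [set aterm_val e t].
Proof.
elim: t P => //= t1 IH1 t2 IH2 P; rewrite IH1 IH2 Rexn_full.
  split=> [[n [/Rplus_set1 -> //]]|h]; exists (aterm_val e t1 + aterm_val e t2).
  by split=> //; apply/Rplus_set1.
split=> [[n [/Rmult_set1 -> //]]|h]; exists (aterm_val e t1 * aterm_val e t2).
by split=> //; apply/Rmult_set1.
Qed.

Lemma Rform_full e0 e1 e2 phi :
  Rform (fun x => [set e0 x]) e1 e2 phi <-> asat e0 e1 e2 phi.
Proof.
elim: phi e0 e1 e2 => /=
  [t1 t2|t1 t2|t x|x y|x y|x y|f IH|f IHf g IHg|x f IH|x f IH|x f IH] e0 e1 e2 //.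
- by rewrite !Rterm_full; split=> [|->//]; move/seteqP=> [/(_ _ erefl)].
- by rewrite !Rterm_full Rlt_set1.
- by rewrite Rterm_full; split=> [/(_ _ erefl)|h _ ->].
- by split=> [h|-> //]; apply/seteqP; split=> A; apply h; apply: U_full.
- by rewrite IH.
- by rewrite IHf IHg.
- rewrite Rexn_full; split=> -[n]; [move=> h; exists n; apply/IH|move=> /IH h; exists n].
    suff <- : update (fun y => [set e0 y]) x [set n] = (fun y => [set update e0 x n y]) by [].
    by apply/funext => y; rewrite /update; case: eqP.
  suff -> : update (fun y => [set e0 y]) x [set n] = (fun y => [set update e0 x n y]) by [].
  by apply/funext => y; rewrite /update; case: eqP.
- by split=> -[A]; [case=> _ /IH h|move/IH=> h]; exists A.
- by split=> -[A]; [case=> _ /IH h|move/IH=> h]; exists A => //; split=> // B _; apply: U_full.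
Qed.

End Meaning.

(** * Correctness of the prenex translation, piece by piece *)

Section LowerSpec.
Variables (N : nat) (U : set (set nat)).
Notation spec := (@spec N U).
Notation ext := (@ext N U).
Implicit Types s : state N.

Create HintDb den.
#[local] Hint Resolve den1_ext den2_ext qden_sub qden_eq qden_lt qden_zero qden_shift
  qden_union qden_zunion qden_isz qden_sing spec_mem : den.

Ltac spec_step :=
  lazymatch goal with
  | |- spec _ _ (c_and _ _) _ => apply: spec_and
  | |- spec _ _ (c_imp _ _) _ => apply: spec_imp
  | |- spec _ _ (c_or _ _) _ => apply: spec_or
  | |- spec _ _ (c_not _) _ => apply: spec_not
  | |- spec _ _ (c_all1 _) _ => apply: spec_all1 => ? ? ? ? ? ?
  | |- spec _ _ (c_all2 _) _ => apply: spec_all2 => ? ? ? ? ? ?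
  | |- spec _ _ (c_ex1 _) _ => apply: spec_ex1 => ? ? ? ? ? ?
  | |- spec _ _ (c_ex2 _) _ => apply: spec_ex2 => ? ? ? ? ? ?
  | |- spec _ _ (c_atom _) _ => apply: spec_atom => ? ? _; solve [eauto 12 with den nocore]
  | |- spec _ _ (c_mem _ _) _ => solve [eauto 12 with den nocore]
  end.

(** The rules compute an exact count of names, one for each quantifier and one for each membership,
    which is then compared with 9. *)
Lemma spec_plus s a b c A B C : den1 s a A -> den1 s b B -> den1 s c C ->
  spec 9 s (c_plus (code_nat a) (code_nat b) (code_nat c)) (Rplus U A B C).
Proof.
move=> da db dc; apply: spec_le; last by rewrite /c_plus; repeat spec_step.
by [].
Qed.
#[local] Hint Resolve spec_plus : den.

Lemma spec_mult s a b c A B C : den1 s a A -> den1 s b B -> den1 s c C ->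
  spec 22 s (c_mult (code_nat a) (code_nat b) (code_nat c)) (Rmult U A B C).
Proof.
move=> da db dc; apply: spec_le; last first.
  by rewrite /c_mult; repeat first [spec_step | solve [eauto 12 with den nocore]].
by [].
Qed.

Lemma spec_exn w s D (P : set nat -> Prop) :
  (forall s' v A, ext s s' -> den1 s' v A -> spec w s' (D (code_nat v)) (P A)) ->
  spec w.+1 s (c_exn D) (Rexn U P).
Proof.
move=> DP; apply: spec_ex1 => s' v A e UA d; rewrite -[w]add0n; apply: spec_and; last exact: DP.
by apply: spec_atom => s'' e' _; apply: qden_sing; exact: den1_ext e' d.
Qed.

Definition env1 s (l : seq nat) (r : tree -> tree) (e : nat -> set nat) : Prop :=
  forall x, x \in l -> exists2 v, r (code_nat x) = code_nat v & den1 s v (e x).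

Definition env2 s (l : seq nat) (r : tree -> tree) (e : nat -> set (set nat)) : Prop :=
  forall x, x \in l -> exists2 v, r (code_nat x) = code_nat v & den2 s v (e x).

Lemma env1_ext s s' l r e : ext s s' -> env1 s l r e -> env1 s' l r e.
Proof. by move=> h hr x /hr[v -> d]; exists v => //; exact: den1_ext h d. Qed.

Lemma env2_ext s s' l r e : ext s s' -> env2 s l r e -> env2 s' l r e.
Proof. by move=> h hr x /hr[v -> d]; exists v => //; exact: den2_ext h d. Qed.

Lemma env1_upd s l r e x v A : env1 s l r e -> den1 s v A ->
  env1 s (x :: l) (tupd r (code_nat x) (code_nat v)) (update e x A).
Proof.
move=> hr d y; rewrite inE tupd_code /update; case: eqP => [_ _|_ /hr //].
by exists v.
Qed.

Lemma env2_upd s l r e x v Y : env2 s l r e -> den2 s v Y ->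
  env2 s (x :: l) (tupd r (code_nat x) (code_nat v)) (update e x Y).
Proof.
move=> hr d y; rewrite inE tupd_code /update; case: eqP => [_ _|_ /hr //].
by exists v.
Qed.

Fixpoint bnd (d : tree) : nat := if d is Node a b then 64 + (bnd a + bnd b) else 0.

Lemma tplus_code m n : tplus (code_nat m) (code_nat n) = code_nat (m + n).
Proof. by elim: m => //= m IH; rewrite /tplus /= -/(tplus _ _) IH. Qed.

Lemma bound_code d : bound d = code_nat (bnd d).
Proof.
elim: d => //= a IHa b IHb; rewrite -!tplus_code -IHa -IHb; reflexivity.
Qed.

(** The cost [w] of the continuation is included because the rest of the formula is translated
    inside the translation of the term; the names of operand values stay valid there by
    [den1_ext]. *)
Lemma spec_term l r e t : aterm_scoped l t -> forall w s k P, env1 s l r e ->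
  (forall s' v A, ext s s' -> den1 s' v A -> spec w s' (k (code_nat v)) (P A)) ->
  spec (bnd (code_aterm t) + w) s (c_term (code_aterm t) r k) (Rterm U e t P).
Proof.
elim: t => [x|t1 IH1 t2 IH2|t1 IH1 t2 IH2] /= lt w s k P hr kP.
- have [v rv d] := hr x lt; apply: (@spec_le _ _ w); first by lia.
  have -> : c_term (code_con 0 [:: code_nat x]) r k = k (r (code_nat x)) by [].
  rewrite rv => s' h le; apply: (kP s' v) => //; first exact: den1_ext h d.
  exact: ext_refl (ext_valid h).
- case/andP: lt => l1 l2.
  apply: (spec_le (w := bnd (code_aterm t1) + (bnd (code_aterm t2) + (9 + w).+1))).
    by lia.
  apply: (IH1 l1 (bnd (code_aterm t2) + (9 + w).+1) s) => // s1 a A h1 da.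
  apply: (IH2 l2 (9 + w).+1 s1); first exact: env1_ext hr.
  move=> s2 b B h2 db; apply: spec_exn => s3 c C h3 dc; apply: spec_and.
    by apply: spec_plus; eauto with den nocore.
  by apply: kP => //; apply: ext_trans h3; apply: ext_trans h2.
- case/andP: lt => l1 l2.
  apply: (spec_le (w := bnd (code_aterm t1) + (bnd (code_aterm t2) + (22 + w).+1))).
    by lia.
  apply: (IH1 l1 (bnd (code_aterm t2) + (22 + w).+1) s) => // s1 a A h1 da.
  apply: (IH2 l2 (22 + w).+1 s1); first exact: env1_ext hr.
  move=> s2 b B h2 db; apply: spec_exn => s3 c C h3 dc; apply: spec_and.
    by apply: spec_mult; eauto with den nocore.
  by apply: kP => //; apply: ext_trans h3; apply: ext_trans h2.
Qed.

Lemma spec_bin l r e t1 t2 s m (R : set nat -> set nat -> Prop) :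
  (forall s' a b A B, den1 s' a A -> den1 s' b B ->
    qden s' (m (code_nat a) (code_nat b)) (R A B)) ->
  aterm_scoped l t1 -> aterm_scoped l t2 -> env1 s l r e ->
  spec (bnd (code_aterm t1) + bnd (code_aterm t2)) s
    (c_bin m r (code_aterm t1) (code_aterm t2))
    (Rterm U e t1 (fun A => Rterm U e t2 (fun B => R A B))).
Proof.
move=> mR l1 l2 hr; apply: (spec_term l1 hr) => s1 a A h1 da; rewrite -[bnd _]addn0.
apply: (spec_term l2 (env1_ext h1 hr)) => s2 b B h2 db.
by apply: spec_atom => s3 h3 _; apply: mR; eauto with den nocore.
Qed.

Lemma spec_form phi : forall l0 l1 l2 s r0 r1 r2 e0 e1 e2, ascoped l0 l1 l2 phi ->
  env1 s l0 r0 e0 -> env1 s l1 r1 e1 -> env2 s l2 r2 e2 ->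
  spec (bnd (code_aformula phi)) s (c_form (code_aformula phi) r0 r1 r2)
    (Rform U e0 e1 e2 phi).
Proof.
elim: phi => [t1 t2|t1 t2|t x|x y|x y|x y|f IH|f IHf g IHg|x f IH|x f IH|x f IH]
  l0 l1 l2 s r0 r1 r2 e0 e1 e2 /= sc_ h0 h1 h2.
- case/andP: sc_ => sc1 sc2; apply: spec_le; last first.
    by apply: (spec_bin (m := qeq) _ sc1 sc2 h0) => *; apply: qden_eq.
  by lia.
- case/andP: sc_ => sc1 sc2; apply: spec_le; last first.
    by apply: (spec_bin (m := qlt) _ sc1 sc2 h0) => *; apply: qden_lt.
  by lia.
- case/andP: sc_ => sc1 sc2; have [v rv d] := h1 _ sc2.
  apply: (@spec_le _ _ (bnd (code_aterm t) + 0)); first by lia.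
  set D := c_form _ _ _ _.
  have {D}-> : D = c_term (code_aterm t) r0 (fun a => c_atom (qsub a (r1 (code_nat x)))) by [].
  rewrite rv; apply: (spec_term sc1 h0) => s' a A h da.
  by apply: spec_atom => s'' h' _; eauto with den nocore.
- case/andP: sc_ => sc1 sc2; have [v rv d] := h1 _ sc1; have [u ru d'] := h2 _ sc2.
  apply: (@spec_le _ _ 1); first by lia.
  set D := c_form _ _ _ _; have {D}-> : D = c_mem (r1 (code_nat x)) (r2 (code_nat y)) by [].
  rewrite rv ru.
  by eauto with den nocore.
- case/andP: sc_ => sc1 sc2; have [v rv d] := h1 _ sc1; have [u ru d'] := h1 _ sc2.
  apply: (@spec_le _ _ 0); first by lia.
  set D := c_form _ _ _ _; have {D}-> : D = c_atom (qeq (r1 (code_nat x)) (r1 (code_nat y))) by [].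
  rewrite rv ru.
  by spec_step.
- case/andP: sc_ => sc1 sc2; have [v rv d] := h2 _ sc1; have [u ru d'] := h2 _ sc2.
  (* One name for the quantifier and one for each of the four memberships in [c_eq2]. *)
  apply: (@spec_le _ _ 5); first by lia.
  set D := c_form _ _ _ _; have {D}-> : D = c_eq2 (r2 (code_nat x)) (r2 (code_nat y)) by [].
  rewrite rv ru.
  by apply: spec_le; last by rewrite /c_eq2; repeat spec_step.
- apply: (@spec_le _ _ (bnd (code_aformula f))); first by lia.
  exact: spec_not (IH _ _ _ _ _ _ _ _ _ _ sc_ h0 h1 h2).
- case/andP: sc_ => sc1 sc2.
  apply: (@spec_le _ _ (bnd (code_aformula f) + bnd (code_aformula g))); first by lia.
  exact: spec_or (IHf _ _ _ _ _ _ _ _ _ _ sc1 h0 h1 h2) (IHg _ _ _ _ _ _ _ _ _ _ sc2 h0 h1 h2).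
- apply: (@spec_le _ _ (bnd (code_aformula f)).+1); first by lia.
  apply: spec_exn => s' v A h d.
  by apply: IH sc_ _ _ _; [apply: env1_upd d|..]; eauto using env1_ext, env2_ext.
- apply: (@spec_le _ _ (bnd (code_aformula f)).+1); first by lia.
  apply: spec_ex1 => s' v A h _ d.
  by apply: IH sc_ _ _ _; [|apply: env1_upd d|]; eauto using env1_ext, env2_ext.
- apply: (@spec_le _ _ (bnd (code_aformula f)).+1); first by lia.
  apply: spec_ex2 => s' v A h _ d.
  by apply: IH sc_ _ _ _; [| |apply: env2_upd d]; eauto using env1_ext, env2_ext.
Qed.

End LowerSpec.

(** * Enforcing fullness, and the resulting sentence *)

Definition atrue (phi : aformula) : Prop :=
  asat (fun=> 0) (fun=> set0) (fun=> set0) phi.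

Definition full N (T : set (trace 'I_N.+1)) : Prop := forall A, exists t, T t /\ xset t = A.

Lemma full_iff N (T : set (trace 'I_N.+1)) : 0 < N -> (exists t, T t) ->
  full T <-> forall T', eq_on [set~ inord 1]%SET T T' -> forall t, T' t ->
    exists t', T' t' /\ forall i, ord0 \in t' i <-> inord 1 \in t i.
Proof.
move=> N0 [t0 Tt0]; have q0 := @ord0_neq_inord N 0 N0; set q := inord 1 in q0 *.
split=> [fT T' eqT t Tt|h A].
  have [t' [Tt' tA]] := fT [set i | q \in t i].
  have [t'' Tt'' eqt] := eq_on_xset q0 eqT Tt'; exists t''; split=> // i.
  by have : xset t'' i <-> [set i | q \in t i] i by rewrite eqt tA.
pose f (t : trace 'I_N.+1) : trace 'I_N.+1 := fun i =>
  if `[< A i >] then (q |: t i)%SET else (t i :\ q)%SET.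
have fE t i p : p != q -> (p \in f t i) = (p \in t i).
  by rewrite /f; case: asboolP => _; rewrite !inE => /negbTE->.
have qf t i : q \in f t i <-> A i.
  by rewrite /f; case: asboolP => h'; rewrite !inE eqxx.
have eqT : eq_on [set~ q]%SET T (f @` T).
  have pf t : proj [set~ q]%SET (f t) = proj [set~ q]%SET t.
    apply/funext => i; apply/setP => p; rewrite !inE.
    by case: (altP (p =P q)) => [_|pq]; rewrite ?andbF ?fE.
  apply/seteqP; split=> u [t Tt <-]; first by exists (f t); [exists t | rewrite pf].
  by case: Tt => t' Tt' <-; exists t'; rewrite ?pf.
have [|t' [Tt' h']] := h _ eqT (f t0); first by exists t0.
have [t Tt eqt] := eq_on_xset q0 (eq_on_sym eqT) Tt'; exists t; split=> //.
by rewrite eqt; apply/seteqP; split=> i; [move/h'/qf | move=> Ai; apply/h'/qf].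
Qed.

Lemma lower_formulaP phi : ascoped [::] [::] [::] phi ->
  let N := 3 + bnd (code_aformula phi) in
  exists f : formula 'I_N.+1,
  [/\ code_formula f = lower_formula (code_aformula phi), scoped [::] f
    & forall T : set (trace 'I_N.+1), (exists t, T t) ->
        models T f <-> full T /\ atrue phi].
Proof.
move=> cl N.
have main (T : set (trace 'I_N.+1)) : (exists t, T t) ->
    tden (State 0 [::] T (@empty_assignment _)) (lower_formula (code_aformula phi))
      (full T /\ atrue phi).
  move=> ne; pose U : set (set nat) := [set A | exists t, T t /\ xset t = A].
  set s0 := State 0 _ _ _; have va0 : valid U s0 by split.
  have N0 : 0 < N by [].
  (* This is the literal reading of the sentence. Its arithmetic part depends on [U] only and can be
     taken out of the quantifiers; it is turned into truth once the other conjunct has shown [T] to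
     be full. *)
  apply: (@tden_iff _ _ _ (forall T', eq_on [set~ inord 1]%SET T T' -> forall t, T' t ->
    exists t', T' t' /\ ((forall i, ord0 \in t' i <-> inord 1 \in t i) /\
      Rform U (fun=> [set 0]) (fun=> set0) (fun=> set0) phi))).
    rewrite (full_iff N0 ne); split=> [h|[h1 h2] T' eqT t Tt]; last first.
      have [t' [Tt' eqt]] := h1 _ eqT t Tt; exists t'; split=> //; split=> //.
      by apply/Rform_full => //; apply/(full_iff N0 ne).
    have fT : full T.
      by apply/(full_iff N0 ne) => T' eqT t /(h _ eqT)[t' [Tt' [eqt _]]]; exists t'.
    split; first exact/(full_iff N0 ne).
    have [t Tt] := ne; have [t' [_ [_]]] := h T erefl t Tt.
    by move/(Rform_full fT).
  apply: (@tden_prop N true s0) => // T' eqT; have e1 := ext_push2 va0 N0 eqT.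
  set s1 := push2 _ _ in e1 *.
  apply: (@tden_trace N U true s1); first exact: ext_valid e1.
  move=> t Tt; have e2 := ext_push1 t (ext_valid e1); set s2 := push1 _ _ in e2 *.
  apply: (@tden_trace N U false s2); first exact: ext_valid e2.
  move=> t' Tt'; have e3 := ext_push1 t' (ext_valid e2); set s3 := push1 _ _ in e3 *.
  (* The context in which the arithmetic sentence stands is monotone, whence the polarity
     [false]. *)
  pose K B := (forall i, ord0 \in t' i <-> inord 1 \in t i) /\ B.
  have envs : env1 s3 [::] id (fun=> [set 0]) /\ env1 s3 [::] id (fun=> set0) by [].
  apply: (@spec_form N U phi _ _ _ s3 id id id _ _ _ cl envs.1 envs.2 _ s3 _ _ false K) => //.
  - exact: ext_refl (ext_valid e3).
  - by move=> P Q PQ [h /PQ].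
  move=> s4 m B e4 _ [psi [<- spsi satP]].
  have [_ [sub Pi_] _ _] := e4.
  (* The formula coded by the copying conjunct of [lower_formula]. *)
  pose E := Neg (Eventually (Neg (Or
    (Neg (Or (Neg (Atom (ord0 : 'I_N.+1) 2)) (Neg (Atom (inord 1) 1))))
    (Neg (Or (Neg (Neg (Atom ord0 2))) (Neg (Neg (Atom (inord 1 : 'I_N.+1) 1)))))))).
  have sE : qf_scoped (ss s4) E by rewrite /= !sub.
  exists (QF (Neg (Or (Neg E) (Neg psi)))); split.
  - by rewrite /= inordK.
  - by rewrite [scoped _ _]/(qf_scoped _ E && qf_scoped _ psi) sE.
  apply: iff_trans (qf_sat_and _ _ E psi) _; rewrite qf_sat_alw satP /K /=.
  rewrite (Pi_ 1) ?(Pi_ 2) //= /update /=.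
  split=> -[h hB]; split=> // i; last move=> _.
    by case: (h i) => // /not_orP[/contrapT ? /contrapT ?]; split.
  have [h1 h2] := h i; have [/[dup] h0 /h1 h3|h0] := pselect (ord0 \in t' i).
    by left; rewrite not_orP !notK.
  by right; rewrite not_orP !notK; split=> // /h2.
(* The formula is extracted once, from the set of all traces; its code makes it the formula for
   every [T]. *)
have [f [cf sf _]] := main setT (ex_intro _ (fun=> finset.set0) I).
exists f; split=> // T /main[f' [cf' _ satP]].
by rewrite -cf in cf'; rewrite (code_formula_inj cf') in satP.
Qed.

Lemma lower_code phi : lower (code_aformula phi) =
  Node (code_nat (3 + bnd (code_aformula phi))) (lower_formula (code_aformula phi)).
Proof. by rewrite /lower bound_code tplus_code. Qed.

Lemma traces_nonempty (AP V : finType) (S : tsystem AP V) : exists t, traces S t.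
Proof.
have [v0 v0P] := init_nonempty S; have [f fP] := choice (edge_total S).
by exists (fun i => label S (iter i f v0)), (fun i => iter i f v0).
Qed.

(** * A transition system showing all sets of numbers, and the lower bounds *)

Section BinarySystem.
Variable n : nat.

Lemma binary_init : exists v : 'I_2, v \in [set: 'I_2]%SET.
Proof. by exists ord0; rewrite inE. Qed.

Definition binary_system : tsystem 'I_n.+1 'I_2 :=
  @TSystem 'I_n.+1 'I_2 (fun _ _ => true) finset.setT
    (fun v => if v == ord0 then finset.set0 else [set ord0]%SET)
    (fun v => ex_intro _ v erefl) binary_init.

(** The code does not depend on the number of propositions, so the system is a constant of the
    reduction. *)
Definition binary_system_code : tree :=
  let s := code_nats [:: 0; 1] in
  Node s (code_seq [:: Node s (code_nats [::]); Node s (code_nats [:: 0])]).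

Lemma code_binary_system : code_tsystem binary_system = binary_system_code.
Proof.
rewrite /code_tsystem /binary_system_code.
have allE (P : pred 'I_2) : P =1 xpredT -> [seq val v | v <- enum 'I_2 & P v] = [:: 0; 1].
  by move=> PT; rewrite (eq_filter PT) filter_predT val_enum_ord.
rewrite allE; last by move=> v; rewrite inE.
have labE : [seq val p | p <- enum 'I_n.+1 & p \in [set ord0]%SET] = [:: 0].
  have eqP p : (p \in [set ord0]%SET) = pred1 (ord0 : 'I_n.+1) p by rewrite inE.
  by rewrite (eq_filter eqP) filter_pred1_uniq ?enum_uniq ?mem_enum.
have lab0 : [seq val p | p <- enum 'I_n.+1 & p \in (finset.set0 : {set 'I_n.+1})] = [::].
  by rewrite (eq_filter (a2 := pred0)) ?filter_pred0 // => p; rewrite inE.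
have mapE (g : 'I_2 -> tree) : map g (enum 'I_2) = [:: g ord0; g (lift ord0 ord0)].
  by rewrite (enum_ordSl 1) (enum_ordSl 0) (size0nil (size_enum_ord 0)).
by rewrite mapE !allE //= labE lab0.
Qed.

Lemma full_binary_system : full (traces binary_system).
Proof.
move=> A; pose rho i : 'I_2 := if `[< A i >] then ord_max else ord0.
exists (fun i => label binary_system (rho i)); split.
  by exists rho; split=> // *; rewrite inE.
by apply/seteqP; split=> i; rewrite /xset /rho /=; case: asboolP => Ai /=; rewrite inE.
Qed.

End BinarySystem.

(** A nonempty model of the sentence forces the arithmetic sentence to be true; conversely a true
    sentence is satisfied by the traces of the binary system, which are full. *)
Lemma third_order_le_satisfiability : reducible third_order_truth satisfiability.
Proof.
apply: (reducible_by real_lower) => -[phi cl].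
have [f [cf sf fP]] := lower_formulaP cl.
exists (HSentence sf); split; first by rewrite /= /code_hsentence /= cf lower_code.
split=> [h|[T [ne /fP[]]]] //=; exists (traces (binary_system _)).
split; first exact: traces_nonempty.
by apply/fP; [exact: traces_nonempty | split=> //; exact: full_binary_system].
Qed.

Lemma third_order_le_finite_state_satisfiability :
  reducible third_order_truth finite_state_satisfiability.
Proof.
apply: (reducible_by real_lower) => -[phi cl].
have [f [cf sf fP]] := lower_formulaP cl.
exists (HSentence sf); split; first by rewrite /= /code_hsentence /= cf lower_code.
split=> [h|[V [S /fP[]]]] //=; last exact: traces_nonempty.
exists _, (binary_system _).
by apply/fP; [exact: traces_nonempty | split=> //; exact: full_binary_system].
Qed.

Definition lower_mc (d : tree) : tree := Node (lower d) binary_system_code.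

Lemma real_lower_mc : real lower_mc. Proof. rewrite /lower_mc; realize. Qed.

Lemma third_order_le_model_checking : reducible third_order_truth model_checking.
Proof.
apply: (reducible_by real_lower_mc) => -[phi cl].
have [f [cf sf fP]] := lower_formulaP cl.
exists (MCInput (mc_sentence := HSentence sf) (binary_system _)); split.
  by rewrite /= /code_mc_input /= code_binary_system /code_hsentence /= cf /lower_mc lower_code.
rewrite /= fP; last exact: traces_nonempty.
by split=> [|[]] //; split=> //; exact: full_binary_system.
Qed.

(** * Translation into third-order arithmetic *)

Definition uvar (v : tree) : tree := con1 (code_nat 0) v.
Definition uadd (t t' : tree) : tree := con2 (code_nat 1) t t'.
Definition umul (t t' : tree) : tree := con2 (code_nat 2) t t'.

(* Translations take the next unused name; number quantifiers pass on the term
   consisting of the bound variable, the other ones its name. *)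
Notation gen := (tree -> tree).

Definition a_eq (t t' : tree) : gen := fun _ => con2 (code_nat 0) t t'.
Definition a_lt (t t' : tree) : gen := fun _ => con2 (code_nat 1) t t'.
Definition a_mem1 (t v : tree) : gen := fun _ => con2 (code_nat 2) t v.
Definition a_mem2 (v w : tree) : gen := fun _ => con2 (code_nat 3) v w.
Definition a_not (D : gen) : gen := fun c => con1 (code_nat 6) (D c).
Definition a_or (D D' : gen) : gen := fun c => con2 (code_nat 7) (D c) (D' c).
Definition a_ex0 (D : tree -> gen) : gen := fun c => con2 (code_nat 8) c (D (uvar c) (tS c)).
Definition a_ex1 (D : tree -> gen) : gen := fun c => con2 (code_nat 9) c (D c (tS c)).
Definition a_ex2 (D : tree -> gen) : gen := fun c => con2 (code_nat 10) c (D c (tS c)).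
Definition a_and (D D' : gen) : gen := a_not (a_or (a_not D) (a_not D')).
Definition a_imp (D D' : gen) : gen := a_or (a_not D) D'.
Definition a_iff (D D' : gen) : gen := a_and (a_imp D D') (a_imp D' D).
Definition a_all0 (D : tree -> gen) : gen := a_not (a_ex0 (fun v => a_not (D v))).
Definition a_all1 (D : tree -> gen) : gen := a_not (a_ex1 (fun v => a_not (D v))).
Definition a_all2 (D : tree -> gen) : gen := a_not (a_ex2 (fun v => a_not (D v))).

(* In the following, [z] and [o] are terms for 0 and 1, and [h] is one for the
   number of propositions. The trace [t] is coded by the set of the [i * h + p]
   such that [p] holds at position [i] of [t]. *)
Definition u_num (z o d : tree) : tree := trec z (fun _ _ _ r => uadd o r) d.

Definition u_qf (z o h : tree) : tree -> (tree -> tree) -> tree -> gen :=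
  rose (fun _ _ => a_eq z z) (fun k args f1 f2 =>
    sw (fun r i => a_mem1 (uadd (umul i h) (u_num z o (thd args))) (r (tthd args)))
   (sw (fun r i => a_not (f1 r i))
   (sw (fun r i => a_or (f1 r i) (f2 r i))
   (sw (fun r i => f1 r (uadd i o))
   (fun _ r i => a_ex0 (fun j => f1 r (uadd i j)))))) k).

(** One inclusion between the projections forgetting [q]: the numbers [i * h + q] are the places
    where proposition [q] is recorded. *)
Definition u_cover (h q T T' : tree) : gen :=
  a_all1 (fun X => a_imp (a_mem2 X T) (a_ex1 (fun X' => a_and (a_mem2 X' T')
    (a_all0 (fun k => a_or (a_ex0 (fun i => a_eq k (uadd (umul i h) q)))
                           (a_iff (a_mem1 k X) (a_mem1 k X'))))))).

Definition u_eqon (h q T T' : tree) : gen := a_and (u_cover h q T T') (u_cover h q T' T).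

Definition u_form (z o h : tree) : tree -> (tree -> tree) -> tree -> gen :=
  rose (fun _ _ => a_eq z z) (fun k args f1 f2 =>
    sw (fun r T => a_ex1 (fun v => a_and (a_mem2 v T) (f2 (tupd r (thd args) v) T)))
   (sw (fun r T => a_all1 (fun v => a_imp (a_mem2 v T) (f2 (tupd r (thd args) v) T)))
   (sw (fun r T => a_ex2 (fun T' => a_and (u_eqon h (u_num z o (thd args)) T T') (f2 r T')))
   (sw (fun r T => a_all2 (fun T' => a_imp (u_eqon h (u_num z o (thd args)) T T') (f2 r T')))
   (fun _ r T => u_qf z o h (thd args) r z)))) k).

(** Terms contain no constants: 0 is obtained as the solution of [z + z = z], and 1 as the
    multiplicative idempotent other than 0. *)
Definition u_top (D : tree -> tree -> gen) : gen :=
  a_ex0 (fun z => a_and (a_eq (uadd z z) z) (a_ex0 (fun o =>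
    a_and (a_eq (umul o o) o) (a_and (a_not (a_eq (uadd o o) o)) (D z o))))).

Definition tsnd (d : tree) : tree := tcase Leaf (fun _ b => b) d.

(** The instance records the largest proposition, hence [uadd o] for their number. *)
Definition upper_sat (d : tree) : tree :=
  u_top (fun z o => a_ex2 (fun T => a_and (a_ex1 (fun X => a_mem2 X T))
    (u_form z o (uadd o (u_num z o (thd d))) (tsnd d) (fun v => v) T))) Leaf.

(* [R] codes the run visiting [v] at position [i] iff [i * m + v \in R]. *)
Definition u_run (o h m I E L X R : tree) : gen :=
  a_and (a_all0 (fun i => a_ex0 (fun v => a_and (a_lt v m) (a_all0 (fun w =>
    a_imp (a_lt w m) (a_iff (a_mem1 (uadd (umul i m) w) R) (a_eq w v)))))))
 (a_and (a_ex0 (fun v => a_and (a_lt v m) (a_and (a_mem1 v R) (a_mem1 v I))))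
 (a_and (a_all0 (fun i => a_all0 (fun v => a_all0 (fun w =>
    a_imp (a_lt v m) (a_imp (a_lt w m) (a_imp (a_mem1 (uadd (umul i m) v) R)
   (a_imp (a_mem1 (uadd (umul (uadd i o) m) w) R) (a_mem1 (uadd (umul v m) w) E))))))))
 (a_all0 (fun i => a_all0 (fun v => a_all0 (fun p =>
    a_imp (a_lt v m) (a_imp (a_lt p h) (a_imp (a_mem1 (uadd (umul i m) v) R)
   (a_iff (a_mem1 (uadd (umul i h) p) X) (a_mem1 (uadd (umul v h) p) L)))))))))).

(* A transition system with vertices [0, ..., m - 1] is given by its initial
   vertices [I], its edges [v * m + w] in [E] and its labels [v * h + p] in [L]. *)
Definition u_system (z o h : tree) (guard : tree -> tree -> tree -> tree -> gen) (d : tree) :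
    gen :=
  a_ex0 (fun m => a_ex1 (fun I => a_ex1 (fun E => a_ex1 (fun L =>
    a_and (guard m I E L)
   (a_and (a_all0 (fun v => a_imp (a_lt v m) (a_ex0 (fun w =>
             a_and (a_lt w m) (a_mem1 (uadd (umul v m) w) E)))))
   (a_and (a_ex0 (fun v => a_and (a_lt v m) (a_mem1 v I)))
   (a_ex2 (fun T => a_and
     (a_all1 (fun X => a_iff (a_mem2 X T) (a_ex1 (fun R => u_run o h m I E L X R))))
     (u_form z o h d (fun v => v) T))))))))).

Definition upper_fs (d : tree) : tree :=
  u_top (fun z o => u_system z o (uadd o (u_num z o (thd d)))
    (fun _ _ _ _ => a_eq z z) (tsnd d)) Leaf.

(** Membership in a list given with the instance is unfolded into a finite disjunction; [z = z]
    negated is the empty one. *)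
Definition u_list (z o b k l : tree) : gen :=
  trec (a_not (a_eq z z)) (fun a _ _ r => a_or (a_eq k (uadd b (u_num z o a))) r) l.

Definition u_rows (z o m k : tree) (proj : tree -> tree) (rows : tree) : tree -> gen :=
  trec (fun _ => a_not (a_eq z z)) (fun row _ _ r v =>
    a_or (u_list z o (umul v m) k (proj row)) (r (uadd v o))) rows.

Definition u_guard (z o h S m I E L : tree) : gen :=
  a_and (a_eq m (u_num z o (tsnd S)))
 (a_and (a_all0 (fun k => a_iff (a_mem1 k I) (u_list z o z k (thd S))))
 (a_and (a_all0 (fun k => a_iff (a_mem1 k E) (u_rows z o m k thd (tsnd S) z)))
        (a_all0 (fun k => a_iff (a_mem1 k L) (u_rows z o h k tsnd (tsnd S) z))))).

Definition upper_mc (d : tree) : tree :=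
  u_top (fun z o => u_system z o (uadd o (u_num z o (thd (thd d))))
    (u_guard z o (uadd o (u_num z o (thd (thd d)))) (tsnd d)) (tsnd (thd d))) Leaf.

(** * Realizability of the translations into arithmetic *)

Lemma real_uvar : real uvar. Proof. rewrite /uvar; realize. Qed.
#[local] Hint Resolve real_uvar : real.
Lemma real_uadd : real uadd. Proof. rewrite /uadd; realize. Qed.
#[local] Hint Resolve real_uadd : real.
Lemma real_umul : real umul. Proof. rewrite /umul; realize. Qed.
#[local] Hint Resolve real_umul : real.
Lemma real_a_eq : real a_eq. Proof. rewrite /a_eq; realize. Qed.
#[local] Hint Resolve real_a_eq : real.
Lemma real_a_lt : real a_lt. Proof. rewrite /a_lt; realize. Qed.
#[local] Hint Resolve real_a_lt : real.
Lemma real_a_mem1 : real a_mem1. Proof. rewrite /a_mem1; realize. Qed.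
#[local] Hint Resolve real_a_mem1 : real.
Lemma real_a_mem2 : real a_mem2. Proof. rewrite /a_mem2; realize. Qed.
#[local] Hint Resolve real_a_mem2 : real.
Lemma real_a_not : real a_not. Proof. rewrite /a_not; realize. Qed.
#[local] Hint Resolve real_a_not : real.
Lemma real_a_or : real a_or. Proof. rewrite /a_or; realize. Qed.
#[local] Hint Resolve real_a_or : real.
Lemma real_a_ex0 : real a_ex0. Proof. rewrite /a_ex0; realize. Qed.
#[local] Hint Resolve real_a_ex0 : real.
Lemma real_a_ex1 : real a_ex1. Proof. rewrite /a_ex1; realize. Qed.
#[local] Hint Resolve real_a_ex1 : real.
Lemma real_a_ex2 : real a_ex2. Proof. rewrite /a_ex2; realize. Qed.
#[local] Hint Resolve real_a_ex2 : real.
Lemma real_a_and : real a_and. Proof. rewrite /a_and; realize. Qed.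
#[local] Hint Resolve real_a_and : real.
Lemma real_a_imp : real a_imp. Proof. rewrite /a_imp; realize. Qed.
#[local] Hint Resolve real_a_imp : real.
Lemma real_a_iff : real a_iff. Proof. rewrite /a_iff; realize. Qed.
#[local] Hint Resolve real_a_iff : real.
Lemma real_a_all0 : real a_all0. Proof. rewrite /a_all0; realize. Qed.
#[local] Hint Resolve real_a_all0 : real.
Lemma real_a_all1 : real a_all1. Proof. rewrite /a_all1; realize. Qed.
#[local] Hint Resolve real_a_all1 : real.
Lemma real_a_all2 : real a_all2. Proof. rewrite /a_all2; realize. Qed.
#[local] Hint Resolve real_a_all2 : real.
Lemma real_u_num : real u_num. Proof. rewrite /u_num; realize. Qed.
#[local] Hint Resolve real_u_num : real.
Lemma real_u_qf : real u_qf. Proof. rewrite /u_qf; realize. Qed.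
#[local] Hint Resolve real_u_qf : real.
Lemma real_u_cover : real u_cover. Proof. rewrite /u_cover; realize. Qed.
#[local] Hint Resolve real_u_cover : real.
Lemma real_u_eqon : real u_eqon. Proof. rewrite /u_eqon; realize. Qed.
#[local] Hint Resolve real_u_eqon : real.
Lemma real_u_form : real u_form. Proof. rewrite /u_form; realize. Qed.
#[local] Hint Resolve real_u_form : real.
Lemma real_u_top : real u_top. Proof. rewrite /u_top; realize. Qed.
#[local] Hint Resolve real_u_top : real.
Lemma real_tsnd : real tsnd. Proof. rewrite /tsnd; realize. Qed.
#[local] Hint Resolve real_tsnd : real.
Lemma real_upper_sat : real upper_sat. Proof. rewrite /upper_sat; realize. Qed.
#[local] Hint Resolve real_upper_sat : real.
Lemma real_u_run : real u_run. Proof. rewrite /u_run; realize. Qed.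
#[local] Hint Resolve real_u_run : real.
Lemma real_u_system : real u_system. Proof. rewrite /u_system; realize. Qed.
#[local] Hint Resolve real_u_system : real.
Lemma real_upper_fs : real upper_fs. Proof. rewrite /upper_fs; realize. Qed.
#[local] Hint Resolve real_upper_fs : real.
Lemma real_u_list : real u_list. Proof. rewrite /u_list; realize. Qed.
#[local] Hint Resolve real_u_list : real.
Lemma real_u_rows : real u_rows. Proof. rewrite /u_rows; realize. Qed.
#[local] Hint Resolve real_u_rows : real.
Lemma real_u_guard : real u_guard. Proof. rewrite /u_guard; realize. Qed.
#[local] Hint Resolve real_u_guard : real.
Lemma real_upper_mc : real upper_mc. Proof. rewrite /upper_mc; realize. Qed.
#[local] Hint Resolve real_upper_mc : real.

(** * Semantics of generated arithmetic formulas *)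

Lemma code_aterm_inj : injective code_aterm.
Proof.
elim=> [x|t1 IH1 t2 IH2|t1 IH1 t2 IH2] [x'|t1' t2'|t1' t2'] //=; case.
- by move/code_nat_inj->.
- by move=> /IH1-> /IH2->.
- by move=> /IH1-> /IH2->.
Qed.

Lemma code_aformula_inj : injective code_aformula.
Proof.
elim=> [t1 t2|t1 t2|t x|x y|x y|x y|f IH|f IHf g IHg|x f IH|x f IH|x f IH]
  [t1' t2'|t1' t2'|t' x'|x' y'|x' y'|x' y'|f'|f' g'|x' f'|x' f'|x' f'] //=; case.
1,2: by move=> /code_aterm_inj-> /code_aterm_inj->.
- by move=> /code_aterm_inj-> /code_nat_inj->.
1-3: by move=> /code_nat_inj-> /code_nat_inj->.
- by move=> /IH->.
- by move=> /IHf-> /IHg->.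
all: by move=> /code_nat_inj-> /IH->.
Qed.

Lemma aterm_scoped_sub l l' t : {subset l <= l'} -> aterm_scoped l t -> aterm_scoped l' t.
Proof.
move=> ll'; elim: t => /= [x|t1 IH1 t2 IH2|t1 IH1 t2 IH2]; first exact: ll'.
1,2: by case/andP=> /IH1-> /IH2->.
Qed.

Lemma aterm_val_agree l e e' t : {in l, e =1 e'} -> aterm_scoped l t ->
  aterm_val e t = aterm_val e' t.
Proof.
move=> ee'; elim: t => /= [x|t1 IH1 t2 IH2|t1 IH1 t2 IH2]; first exact: ee'.
1,2: by case/andP=> /IH1-> /IH2->.
Qed.

Record astate := AState {
  ac : nat;
  l0 : seq nat; l1 : seq nat; l2 : seq nat;
  v0 : nat -> nat; v1 : nat -> set nat; v2 : nat -> set (set nat)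
}.

Definition avalid (s : astate) : Prop := forall v, v \in l0 s ++ l1 s ++ l2 s -> v < ac s.

Definition agree (V : Type) (l l' : seq nat) (e e' : nat -> V) : Prop :=
  {subset l <= l'} /\ {in l, e' =1 e}.

Definition aext (s s' : astate) : Prop :=
  [/\ agree (l0 s) (l0 s') (v0 s) (v0 s'), agree (l1 s) (l1 s') (v1 s) (v1 s'),
      agree (l2 s) (l2 s') (v2 s) (v2 s') & avalid s'].

Definition nden (s : astate) (d : tree) (n : nat) : Prop :=
  exists t, [/\ code_aterm t = d, aterm_scoped (l0 s) t & aterm_val (v0 s) t = n].

Definition sden (s : astate) (d : tree) (A : set nat) : Prop :=
  exists x, [/\ code_nat x = d, x \in l1 s & v1 s x = A].

Definition fden (s : astate) (d : tree) (Y : set (set nat)) : Prop :=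
  exists x, [/\ code_nat x = d, x \in l2 s & v2 s x = Y].

Definition fmden (s : astate) (d : tree) (P : Prop) : Prop :=
  exists phi, [/\ code_aformula phi = d, ascoped (l0 s) (l1 s) (l2 s) phi
    & asat (v0 s) (v1 s) (v2 s) phi <-> P].

Definition aspec (s : astate) (D : gen) (P : Prop) : Prop :=
  forall s', aext s s' -> fmden s' (D (code_nat (ac s'))) P.

Lemma agree_trans (V : Type) (l l' l'' : seq nat) (e e' e'' : nat -> V) :
  agree l l' e e' -> agree l' l'' e' e'' -> agree l l'' e e''.
Proof.
by move=> [ll ee] [ll' ee']; split=> v lv; [apply/ll'/ll | rewrite ee' ?ee //; apply: ll].
Qed.

Lemma aext_valid s s' : aext s s' -> avalid s'. Proof. by case. Qed.

Lemma aext_refl s : avalid s -> aext s s. Proof. by move=> va; do !split. Qed.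

Lemma aext_trans s s' s'' : aext s s' -> aext s' s'' -> aext s s''.
Proof. by move=> [h0 h1 h2 _] [h0' h1' h2' va]; split=> //; apply: agree_trans; eassumption. Qed.

Lemma nden_ext s s' d n : aext s s' -> nden s d n -> nden s' d n.
Proof.
move=> [[ll ee] _ _ _] [t [<- st <-]]; exists t; split=> //.
  exact: aterm_scoped_sub st.
exact: aterm_val_agree st.
Qed.

Lemma sden_ext s s' d A : aext s s' -> sden s d A -> sden s' d A.
Proof. by move=> [_ [ll ee] _ _] [x [<- lx <-]]; exists x; split; rewrite ?ee //; apply: ll. Qed.

Lemma fden_ext s s' d Y : aext s s' -> fden s d Y -> fden s' d Y.
Proof. by move=> [_ _ [ll ee] _] [x [<- lx <-]]; exists x; split; rewrite ?ee //; apply: ll. Qed.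

Lemma nden_add s d d' n n' : nden s d n -> nden s d' n' -> nden s (uadd d d') (n + n').
Proof.
move=> [t [<- st <-]] [t' [<- st' <-]]; exists (APlus t t').
by split=> //=; rewrite st.
Qed.

Lemma nden_mul s d d' n n' : nden s d n -> nden s d' n' -> nden s (umul d d') (n * n').
Proof.
move=> [t [<- st <-]] [t' [<- st' <-]]; exists (AMult t t').
by split=> //=; rewrite st.
Qed.

Lemma aspec_iff s D P P' : (P <-> P') -> aspec s D P -> aspec s D P'.
Proof. by move/propext->. Qed.

Lemma aspec_eq s d d' n n' : nden s d n -> nden s d' n' -> aspec s (a_eq d d') (n = n').
Proof.
move=> hd hd' s' e; have [t [<- st <-]] := nden_ext e hd.
have [t' [<- st' <-]] := nden_ext e hd'; exists (AEq t t').
by split=> //=; rewrite st.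
Qed.

Lemma aspec_lt s d d' n n' : nden s d n -> nden s d' n' -> aspec s (a_lt d d') (n < n').
Proof.
move=> hd hd' s' e; have [t [<- st <-]] := nden_ext e hd.
have [t' [<- st' <-]] := nden_ext e hd'; exists (ALt t t').
by split=> //=; rewrite st.
Qed.

Lemma aspec_mem1 s d v n A : nden s d n -> sden s v A -> aspec s (a_mem1 d v) (A n).
Proof.
move=> hd hv s' e; have [t [<- st <-]] := nden_ext e hd.
have [x [<- lx <-]] := sden_ext e hv; exists (AMem1 t x).
by split=> //=; rewrite st.
Qed.

Lemma aspec_mem2 s v w A Y : sden s v A -> fden s w Y -> aspec s (a_mem2 v w) (Y A).
Proof.
move=> hv hw s' e; have [x [<- lx <-]] := sden_ext e hv.
have [y [<- ly <-]] := fden_ext e hw; exists (AMem2 x y).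
by split=> //=; rewrite lx.
Qed.

Lemma aspec_not s D P : aspec s D P -> aspec s (a_not D) (~ P).
Proof.
move=> DP s' e; have [f [cf sf satP]] := DP s' e; exists (ANot f).
by split=> //=; rewrite ?cf ?satP.
Qed.

Lemma aspec_or s D D' P P' : aspec s D P -> aspec s D' P' -> aspec s (a_or D D') (P \/ P').
Proof.
move=> DP DP' s' e; have [f [cf sf satP]] := DP s' e.
have [g [cg sg satP']] := DP' s' e; exists (AOr f g).
by split=> /=; rewrite ?cf ?cg ?sf ?satP ?satP'.
Qed.

Lemma aspec_and s D D' P P' : aspec s D P -> aspec s D' P' -> aspec s (a_and D D') (P /\ P').
Proof.
move=> DP DP'; apply: (@aspec_iff _ _ (~ (~ P \/ ~ P'))).
  by rewrite not_orP !notK.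
by apply/aspec_not/aspec_or; apply: aspec_not.
Qed.

Lemma aspec_imp s D D' (P P' : Prop) :
  aspec s D P -> aspec s D' P' -> aspec s (a_imp D D') (P -> P').
Proof.
move=> DP DP'; apply: (@aspec_iff _ _ (~ P \/ P')); first by rewrite implyE.
by apply: aspec_or => //; apply: aspec_not.
Qed.

Lemma aspec_iffP s D D' P P' : aspec s D P -> aspec s D' P' -> aspec s (a_iff D D') (P <-> P').
Proof. by move=> DP DP'; apply: aspec_and; apply: aspec_imp. Qed.

Definition apush0 (s : astate) n : astate :=
  AState (ac s).+1 (ac s :: l0 s) (l1 s) (l2 s) (update (v0 s) (ac s) n) (v1 s) (v2 s).
Definition apush1 (s : astate) A : astate :=
  AState (ac s).+1 (l0 s) (ac s :: l1 s) (l2 s) (v0 s) (update (v1 s) (ac s) A) (v2 s).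
Definition apush2 (s : astate) Y : astate :=
  AState (ac s).+1 (l0 s) (l1 s) (ac s :: l2 s) (v0 s) (v1 s) (update (v2 s) (ac s) Y).

Lemma agree_push (V : Type) (l : seq nat) (e : nat -> V) c a :
  (forall v, v \in l -> v < c) -> agree l (c :: l) e (update e c a).
Proof.
move=> lt; split=> v lv; first by rewrite inE lv orbT.
by rewrite /update ltn_eqF ?lt.
Qed.

Lemma agree_refl (V : Type) (l : seq nat) (e : nat -> V) : agree l l e e.
Proof. by split. Qed.

Lemma aext_push0 s n : avalid s -> aext s (apush0 s n).
Proof.
move=> va; split; [|exact: agree_refl|exact: agree_refl|].
  by apply: agree_push => v lv; apply: va; rewrite mem_cat lv.
by move=> v; rewrite inE => /orP[/eqP->|/va/ltnW].
Qed.

Lemma aext_push1 s A : avalid s -> aext s (apush1 s A).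
Proof.
move=> va; split; [exact: agree_refl| |exact: agree_refl|].
  by apply: agree_push => v lv; apply: va; rewrite !mem_cat lv orbT.
move=> v; rewrite !mem_cat inE => h.
have [->//|lv] := eqVneq v (ac s); apply/ltnW/va.
by move: h; rewrite (negbTE lv) !mem_cat.
Qed.

Lemma aext_push2 s Y : avalid s -> aext s (apush2 s Y).
Proof.
move=> va; split; [exact: agree_refl|exact: agree_refl| |].
  by apply: agree_push => v lv; apply: va; rewrite !mem_cat lv !orbT.
move=> v; rewrite !mem_cat inE => h.
have [->//|lv] := eqVneq v (ac s); apply/ltnW/va.
by move: h; rewrite (negbTE lv) !mem_cat.
Qed.

Lemma aspec_ex0 s D (P : nat -> Prop) :
  (forall s' d n, aext s s' -> nden s' d n -> aspec s' (D d) (P n)) ->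
  aspec s (a_ex0 D) (exists n, P n).
Proof.
move=> DP s' e; have va := aext_valid e.
have main n : fmden (apush0 s' n) (D (uvar (code_nat (ac s'))) (code_nat (ac s').+1)) (P n).
  have e' := aext_push0 n va; apply: DP (apush0 s' n) _; [exact: aext_trans e' | |].
    by exists (AVar (ac s')); split; rewrite //= ?inE /update eqxx.
  exact/aext_refl/(aext_valid e').
have [f [cf sf _]] := main 0; exists (AEx0 (ac s') f); split=> //=; first by rewrite cf.
by split=> -[n h]; exists n; have [g [cg _ hg]] := main n;
  rewrite -cf in cg; rewrite (code_aformula_inj cg) in hg; apply/hg.
Qed.

Lemma aspec_ex1 s D (P : set nat -> Prop) :
  (forall s' d A, aext s s' -> sden s' d A -> aspec s' (D d) (P A)) ->
  aspec s (a_ex1 D) (exists A, P A).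
Proof.
move=> DP s' e; have va := aext_valid e.
have main A : fmden (apush1 s' A) (D (code_nat (ac s')) (code_nat (ac s').+1)) (P A).
  have e' := aext_push1 A va; apply: DP (apush1 s' A) _; [exact: aext_trans e' | |].
    by exists (ac s'); split; rewrite //= ?inE /update eqxx.
  exact/aext_refl/(aext_valid e').
have [f [cf sf _]] := main set0; exists (AEx1 (ac s') f); split=> //=; first by rewrite cf.
by split=> -[n h]; exists n; have [g [cg _ hg]] := main n;
  rewrite -cf in cg; rewrite (code_aformula_inj cg) in hg; apply/hg.
Qed.

Lemma aspec_ex2 s D (P : set (set nat) -> Prop) :
  (forall s' d Y, aext s s' -> fden s' d Y -> aspec s' (D d) (P Y)) ->
  aspec s (a_ex2 D) (exists Y, P Y).
Proof.
move=> DP s' e; have va := aext_valid e.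
have main A : fmden (apush2 s' A) (D (code_nat (ac s')) (code_nat (ac s').+1)) (P A).
  have e' := aext_push2 A va; apply: DP (apush2 s' A) _; [exact: aext_trans e' | |].
    by exists (ac s'); split; rewrite //= ?inE /update eqxx.
  exact/aext_refl/(aext_valid e').
have [f [cf sf _]] := main set0; exists (AEx2 (ac s') f); split=> //=; first by rewrite cf.
by split=> -[n h]; exists n; have [g [cg _ hg]] := main n;
  rewrite -cf in cg; rewrite (code_aformula_inj cg) in hg; apply/hg.
Qed.

Lemma aspec_all0 s D (P : nat -> Prop) :
  (forall s' d n, aext s s' -> nden s' d n -> aspec s' (D d) (P n)) ->
  aspec s (a_all0 D) (forall n, P n).
Proof.
move=> DP; apply: (@aspec_iff _ _ (~ exists n, ~ P n)).
  by rewrite -forallNP; split=> h n; [apply: contrapT | move/(_ (h n))].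
by apply/aspec_not/aspec_ex0 => s' d n e hd; apply/aspec_not/DP.
Qed.

Lemma aspec_all1 s D (P : set nat -> Prop) :
  (forall s' d A, aext s s' -> sden s' d A -> aspec s' (D d) (P A)) ->
  aspec s (a_all1 D) (forall A, P A).
Proof.
move=> DP; apply: (@aspec_iff _ _ (~ exists n, ~ P n)).
  by rewrite -forallNP; split=> h n; [apply: contrapT | move/(_ (h n))].
by apply/aspec_not/aspec_ex1 => s' d n e hd; apply/aspec_not/DP.
Qed.

Lemma aspec_all2 s D (P : set (set nat) -> Prop) :
  (forall s' d Y, aext s s' -> fden s' d Y -> aspec s' (D d) (P Y)) ->
  aspec s (a_all2 D) (forall Y, P Y).
Proof.
move=> DP; apply: (@aspec_iff _ _ (~ exists n, ~ P n)).
  by rewrite -forallNP; split=> h n; [apply: contrapT | move/(_ (h n))].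
by apply/aspec_not/aspec_ex2 => s' d n e hd; apply/aspec_not/DP.
Qed.

Create HintDb aden.
#[local] Hint Resolve nden_add nden_mul nden_ext sden_ext fden_ext
  aspec_eq aspec_lt aspec_mem1 aspec_mem2 : aden.

Ltac aspec_step :=
  lazymatch goal with
  | |- aspec _ (a_and _ _) _ => apply: aspec_and
  | |- aspec _ (a_imp _ _) _ => apply: aspec_imp
  | |- aspec _ (a_iff _ _) _ => apply: aspec_iffP
  | |- aspec _ (a_or _ _) _ => apply: aspec_or
  | |- aspec _ (a_not _) _ => apply: aspec_not
  | |- aspec _ (a_ex0 _) _ => apply: aspec_ex0 => ? ? ? ? ?
  | |- aspec _ (a_ex1 _) _ => apply: aspec_ex1 => ? ? ? ? ?
  | |- aspec _ (a_ex2 _) _ => apply: aspec_ex2 => ? ? ? ? ?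
  | |- aspec _ (a_all0 _) _ => apply: aspec_all0 => ? ? ? ? ?
  | |- aspec _ (a_all1 _) _ => apply: aspec_all1 => ? ? ? ? ?
  | |- aspec _ (a_all2 _) _ => apply: aspec_all2 => ? ? ? ? ?
  | |- aspec _ _ _ => solve [eauto 20 with aden nocore]
  end.

Definition Rcover (n q : nat) (Y Y' : set (set nat)) : Prop :=
  forall A, Y A -> exists A', Y' A' /\
    forall k, (exists i, k = i * n + q) \/ (A k <-> A' k).

Lemma aspec_eqon s h q T T' n p Y Y' :
  nden s h n -> nden s q p -> fden s T Y -> fden s T' Y' ->
  aspec s (u_eqon h q T T') (Rcover n p Y Y' /\ Rcover n p Y' Y).
Proof. by move=> hh hq hT hT'; rewrite /u_eqon /u_cover; repeat aspec_step. Qed.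

Definition Rrun (h m : nat) (I E L X R : set nat) : Prop :=
  (forall i, exists v, v < m /\ forall w, w < m -> (R (i * m + w) <-> w = v)) /\
  (exists v, v < m /\ R v /\ I v) /\
  (forall i v w, v < m -> w < m -> R (i * m + v) -> R ((i + 1) * m + w) -> E (v * m + w)) /\
  (forall i v p, v < m -> p < h -> R (i * m + v) -> (X (i * h + p) <-> L (v * h + p))).

Lemma aspec_run s o h m I E L X R h' m' I' E' L' X' R' :
  nden s o 1 -> nden s h h' -> nden s m m' -> sden s I I' -> sden s E E' -> sden s L L' ->
  sden s X X' -> sden s R R' ->
  aspec s (u_run o h m I E L X R) (Rrun h' m' I' E' L' X' R').
Proof. by move=> *; rewrite /u_run /Rrun; repeat aspec_step. Qed.

Lemma nden_num s z o p : nden s z 0 -> nden s o 1 -> nden s (u_num z o (code_nat p)) p.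
Proof.
by move=> hz ho; elim: p => [|p IH] //; rewrite -add1n; apply: nden_add.
Qed.

(** [u_num] follows the right spine only, so on a list it counts the elements; the number of
    vertices is read off the list of rows in this way. *)
Lemma nden_size s z o l : nden s z 0 -> nden s o 1 -> nden s (u_num z o (code_seq l)) (size l).
Proof.
by move=> hz ho; elim: l => [|d l IH] //=; rewrite -add1n; apply: nden_add.
Qed.

(** The rule [aspec_ex0] would require the meaning of the body at all values of the two variables,
    but it is known only at 0 and 1. The formula is therefore built explicitly, and its guards
    exclude the other values. *)
Lemma aspec_top s D P :
  (forall s' z o, aext s s' -> nden s' z 0 -> nden s' o 1 -> aspec s' (D z o) P) ->
  aspec s (u_top D) P.
Proof.
move=> DP s' e; set c := ac s'.
have e1 := aext_push0 0 (aext_valid e); set s1 := apush0 s' 0 in e1.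
have e2 := aext_push0 1 (aext_valid e1); set s2 := apush0 s1 1 in e2.
have cc : (c == c.+1) = false by rewrite ltn_eqF.
have [f [cf sf satP]] : fmden s2 (D (uvar (code_nat c)) (uvar (code_nat c.+1))
    (code_nat c.+2)) P.
  apply: (DP s2); last exact/aext_refl/(aext_valid e2).
  - by apply: aext_trans e2; apply: aext_trans e1.
  - by exists (AVar c); split; rewrite //= ?inE /update ?eqxx ?orbT ?cc.
  - by exists (AVar c.+1); split; rewrite //= ?inE /update ?eqxx.
pose conj a b := ANot (AOr (ANot a) (ANot b)); pose z := AVar c; pose o := AVar c.+1.
exists (AEx0 c (conj (AEq (APlus z z) z) (AEx0 c.+1 (conj (AEq (AMult o o) o)
  (conj (ANot (AEq (APlus o o) o)) f))))); split.
- by rewrite /= cf.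
- by rewrite /= !inE !eqxx /= sf.
rewrite -satP /=; split=> [[a]|h].
  rewrite not_orP !notK {1 2 3}/update eqxx => -[az [b]].
  rewrite !not_orP !notK /update eqxx => -[bb [nb h]].
  have a0 : a = 0 by lia.
  have b1 : b = 1 by nia.
  by rewrite a0 b1 in h.
exists 0; rewrite not_orP !notK {1 2 3}/update eqxx; split=> //; exists 1.
by rewrite !not_orP !notK /update eqxx.
Qed.

(** * Traces as sets of numbers, and the semantics of HyperQPTL+ in arithmetic *)

Section Coding.
Variable n : nat.
Notation AP := 'I_n.+1.
Implicit Types (t : trace AP) (A : set nat).

Definition enc t : set nat := [set k | inord (k %% n.+1) \in t (k %/ n.+1)].

Definition dec A : trace AP := fun i => [set p : AP | `[< A (i * n.+1 + p) >]]%SET.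

Lemma encE t i (p : AP) : enc t (i * n.+1 + p) <-> p \in t i.
Proof.
by rewrite /enc /= divnMDl // modnMDl divn_small // modn_small // addn0 inord_val.
Qed.

Lemma decE A i (p : AP) : p \in dec A i <-> A (i * n.+1 + p).
Proof. by rewrite inE; split=> /asboolP. Qed.

Lemma encK t : dec (enc t) = t.
Proof.
by apply/funext => i; apply/setP => p; apply/idP/idP; [move/decE/encE | move/encE/decE].
Qed.

Lemma ordinal_code k : exists i (p : AP), k = i * n.+1 + p.
Proof.
exists (k %/ n.+1), (inord (k %% n.+1)).
by rewrite inordK ?ltn_mod // -divn_eq.
Qed.

Lemma decK A : enc (dec A) = A.
Proof.
apply/seteqP; split=> k; have [i [p ->]] := ordinal_code k.
  by move/encE/decE.
by move=> Ak; apply/encE/decE.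
Qed.

Definition decs (Y : set (set nat)) : set (trace AP) := [set t | Y (enc t)].

Lemma proj_eq_iff (q : AP) t t' : proj [set~ q]%SET t = proj [set~ q]%SET t' <->
  forall k, (exists i, k = i * n.+1 + q) \/ (enc t k <-> enc t' k).
Proof.
split=> [eqt k|h].
  have [i [p ->]] := ordinal_code k; have [->|pq] := eqVneq p q; first by left; exists i.
  right; rewrite !encE.
  have /setP/(_ p) : proj [set~ q]%SET t i = proj [set~ q]%SET t' i by rewrite eqt.
  by rewrite !inE pq !andbT => ->.
apply/funext => i; apply/setP => p; rewrite !inE.
have [_|pq] := eqVneq p q; rewrite ?andbF // !andbT.
have [[i' /(congr1 (modn^~ n.+1))]|e] := h (i * n.+1 + p).
  by rewrite !modnMDl !modn_small // => /val_inj eqpq; rewrite eqpq eqxx in pq.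
by apply/idP/idP => /encE/e/encE.
Qed.

Lemma Rcover_iff (q : AP) Y Y' :
  Rcover n.+1 q Y Y' <-> proj [set~ q]%SET @` decs Y `<=` proj [set~ q]%SET @` decs Y'.
Proof.
split=> [c _ [t Yt <-]|c A YA].
  have [A [YA hA]] := c _ Yt; exists (dec A); rewrite /decs /= ?decK //.
  by apply/esym/proj_eq_iff => k; rewrite decK.
have [|t Yt eqt] := c (proj [set~ q]%SET (dec A)); first by exists (dec A); rewrite /decs /= ?decK.
by exists (enc t); split=> //; have /esym/proj_eq_iff := eqt; rewrite decK.
Qed.

Lemma Rcover_eq_on (q : AP) Y Y' : Rcover n.+1 q Y Y' /\ Rcover n.+1 q Y' Y <->
  eq_on [set~ q]%SET (decs Y) (decs Y').
Proof.
by rewrite !Rcover_iff; split=> [[c c']|/seteqP //]; apply/seteqP.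
Qed.

Section Formulas.
Variables z o h : tree.

Definition base s : Prop := [/\ nden s z 0, nden s o 1 & nden s h n.+1].

Lemma base_ext s s' : aext s s' -> base s -> base s'.
Proof. by move=> e [? ? ?]; split; apply: nden_ext e _. Qed.

Definition uenv s (l : seq nat) (r : tree -> tree) (Pi : assignment AP) : Prop :=
  forall x, x \in l -> exists t, Pi x = Some t /\ sden s (r (code_nat x)) (enc t).

Lemma uenv_ext s s' l r Pi : aext s s' -> uenv s l r Pi -> uenv s' l r Pi.
Proof. by move=> e hr x /hr[t [-> d]]; exists t; split=> //; apply: sden_ext e d. Qed.

Lemma uenv_upd s l r Pi x v t : uenv s l r Pi -> sden s v (enc t) ->
  uenv s (x :: l) (tupd r (code_nat x) v) (update Pi x (Some t)).
Proof.
move=> hr d y; rewrite inE tupd_code /update; case: eqP => [_ _|_ /hr //].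
by exists t.
Qed.

Lemma aspec_qf (psi : qf_formula AP) : forall l s r i j Pi, qf_scoped l psi -> base s ->
  uenv s l r Pi -> nden s i j -> aspec s (u_qf z o h (code_qf psi) r i) (qf_sat Pi j psi).
Proof.
elim: psi => [p x|f IH|f IHf g IHg|f IH|f IH] l s r i j Pi /= sc_ hb hr hi.
- have [t [-> d]] := hr x sc_; have [hz ho hh] := hb.
  set D := u_qf _ _ _ _ _ _.
  have {D}-> : D = a_mem1 (uadd (umul i h) (u_num z o (code_nat p))) (r (code_nat x)) by [].
  apply: aspec_iff (encE t j p) _.
  by apply: aspec_mem1 d; apply: nden_add; [apply: nden_mul | apply: nden_num].
- exact: aspec_not (IH _ _ _ _ _ _ sc_ hb hr hi).
- case/andP: sc_ => sf sg.
  exact: aspec_or (IHf _ _ _ _ _ _ sf hb hr hi) (IHg _ _ _ _ _ _ sg hb hr hi).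
- apply: (IH _ _ _ (uadd i o) _ _ sc_ hb hr); rewrite -addn1.
  by have [_ ho _] := hb; apply: nden_add.
- apply: (@aspec_iff _ _ (exists k, qf_sat Pi (j + k) f)).
    split=> [[k hk]|[k [jk hk]]]; first by exists (j + k); rewrite leq_addr.
    by exists (k - j); rewrite subnKC.
  apply: (@aspec_ex0 s (fun k => u_qf z o h (code_qf f) r (uadd i k))) => s' d k e hk.
  apply: (IH _ _ _ _ _ _ sc_); [exact: base_ext hb | exact: uenv_ext hr |].
  by apply: nden_add => //; apply: nden_ext hi.
Qed.

Lemma aspec_form (phi : formula AP) : forall l s r T Y Pi, scoped l phi -> base s ->
  uenv s l r Pi -> fden s T Y ->
  aspec s (u_form z o h (code_formula phi) r T) (sat (decs Y) Pi 0 phi).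
Proof.
elim: phi => [x f IH|x f IH|q f IH|q f IH|m] l s r T Y Pi /= sc_ hb hr hT.
- apply: (@aspec_iff _ _ (exists A, Y A /\ sat (decs Y) (update Pi x (Some (dec A))) 0 f)).
    split=> [[A [YA hA]]|[t [Tt ht]]]; first by exists (dec A); rewrite /decs /= decK.
    by exists (enc t); rewrite encK.
  apply: (@aspec_ex1 s (fun v => a_and (a_mem2 v T)
    (u_form z o h (code_formula f) (tupd r (code_nat x) v) T))) => s' d A e hA.
  have hT' := fden_ext e hT; apply: aspec_and; first exact: aspec_mem2.
  apply: (IH (x :: l)) => //; first exact: base_ext hb.
  by apply: uenv_upd; [exact: uenv_ext hr | rewrite decK].
- apply: (@aspec_iff _ _ (forall A, Y A -> sat (decs Y) (update Pi x (Some (dec A))) 0 f)).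
    split=> [hA t /hA|ht A YA]; first by rewrite encK.
    by apply: ht; rewrite /decs /= decK.
  apply: (@aspec_all1 s (fun v => a_imp (a_mem2 v T)
    (u_form z o h (code_formula f) (tupd r (code_nat x) v) T))) => s' d A e hA.
  have hT' := fden_ext e hT; apply: aspec_imp; first exact: aspec_mem2.
  apply: (IH (x :: l)) => //; first exact: base_ext hb.
  by apply: uenv_upd; [exact: uenv_ext hr | rewrite decK].
- apply: (@aspec_iff _ _ (exists Y', (Rcover n.+1 q Y Y' /\ Rcover n.+1 q Y' Y) /\
    sat (decs Y') Pi 0 f)).
    split=> [[Y' [/Rcover_eq_on]]|[T' [eqT hT']]].
      by move=> eqT hT'; exists (decs Y').
    (* Every set of traces is [decs] of a set of sets, so quantifying over the latter loses
       nothing. *)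
    have eqT' : decs [set A | T' (dec A)] = T'.
      by apply/seteqP; split=> t; rewrite /decs /= encK.
    by exists [set A | T' (dec A)]; rewrite Rcover_eq_on eqT'.
  apply: (@aspec_ex2 s (fun T' => a_and (u_eqon h (u_num z o (code_nat q)) T T')
    (u_form z o h (code_formula f) r T'))) => s' d Y' e hY'.
  have hT' := fden_ext e hT; have hb' := base_ext e hb; have [hz ho hh] := hb'.
  apply: aspec_and; first by apply: aspec_eqon => //; apply: nden_num.
  by apply: (IH l) => //; exact: uenv_ext hr.
- apply: (@aspec_iff _ _ (forall Y', (Rcover n.+1 q Y Y' /\ Rcover n.+1 q Y' Y) ->
    sat (decs Y') Pi 0 f)).
    split=> [hY T' eqT|hT' Y' /Rcover_eq_on/hT' //].
    have eqT' : decs [set A | T' (dec A)] = T'.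
      by apply/seteqP; split=> t; rewrite /decs /= encK.
    by rewrite -eqT'; apply: hY; rewrite Rcover_eq_on eqT'.
  apply: (@aspec_all2 s (fun T' => a_imp (u_eqon h (u_num z o (code_nat q)) T T')
    (u_form z o h (code_formula f) r T'))) => s' d Y' e hY'.
  have hT' := fden_ext e hT; have hb' := base_ext e hb; have [hz ho hh] := hb'.
  apply: aspec_imp; first by apply: aspec_eqon => //; apply: nden_num.
  by apply: (IH l) => //; exact: uenv_ext hr.
- by have [hz _ _] := hb; apply: (aspec_qf sc_ hb hr hz).
Qed.

End Formulas.
End Coding.

(** * Finite transition systems as tuples of a number and three sets *)

Section Systems.
Variable n : nat.
Notation AP := 'I_n.+1.

Definition represents m (I E L : set nat) (S : tsystem AP 'I_m) : Prop :=
  [/\ forall v : 'I_m, I v <-> v \in init S,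
      forall v w : 'I_m, E (v * m + w) <-> edge S v w
    & forall (v : 'I_m) (p : AP), L (v * n.+1 + p) <-> p \in label S v].

Lemma mixed_radix_inj m i i' (v w : 'I_m) : i * m + v = i' * m + w -> i = i' /\ v = w.
Proof.
move=> e; have m0 : 0 < m by apply: leq_ltn_trans (ltn_ord v).
have := congr1 (modn^~ m) e; rewrite !modnMDl !modn_small // => /val_inj vw.
split=> //; have := congr1 (divn^~ m) e.
by rewrite vw !divnMDl // !divn_small // !addn0.
Qed.

(** A path is recovered from [R] by choosing the unique vertex at each position; conversely [R] is
    the graph of the path, written in mixed radix. *)
Lemma run_traces m I E L (S : tsystem AP 'I_m) X : represents I E L S ->
  (exists R, Rrun n.+1 m I E L X R) <-> traces S (dec n X).
Proof.
move=> [IP EP LP]; split=> [[R [run [[v [vm [Rv Iv]]] [edges labels]]]]|[rho [rho0 rhoS] eqX]].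
  have /choice[rho rhoP] i : exists v : 'I_m, forall w : 'I_m, R (i * m + w) <-> w = v.
    have [v' [vm' vP]] := run i; exists (Ordinal vm') => w; rewrite vP //.
    by split=> [e|-> //]; apply: val_inj.
  have rhoR i : R (i * m + rho i) by apply/rhoP.
  exists rho; first split=> [|i].
  - have <- : Ordinal vm = rho 0 by apply/rhoP.
    by apply/IP.
  - by apply/EP; apply: edges (rhoR i) _ => //; rewrite addn1; apply: rhoR.
  - apply/funext => i; apply/setP => p; apply/idP/idP.
      by move/decE/(labels i (rho i) p (ltn_ord _) (ltn_ord _) (rhoR i))/LP.
    by move=> h; apply/decE/(labels i (rho i) p (ltn_ord _) (ltn_ord _) (rhoR i))/LP.
pose R := [set k | exists i, k = i * m + rho i].
have RP i (w : 'I_m) : R (i * m + w) <-> w = rho i.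
  by split=> [[i' /mixed_radix_inj[-> ->]]|->] //; exists i.
exists R; split=> [i|].
  exists (rho i); split=> // w wm; rewrite (RP i (Ordinal wm)).
  by split=> [<- //|e]; apply: val_inj.
split; first by exists (rho 0); split=> //; split; [exists 0 | apply/IP].
split=> [i v w vm wm|i v p vm pn].
  move=> /(RP i (Ordinal vm)) ev; rewrite addn1 => /(RP i.+1 (Ordinal wm)) ew.
  by apply/(EP (Ordinal vm) (Ordinal wm)); rewrite ev ew.
move=> /(RP i (Ordinal vm)) ev; rewrite (LP (Ordinal vm) (Ordinal pn)) ev.
by rewrite -(decE X i (Ordinal pn)) eqX.
Qed.

Definition Rsystem (G : nat -> set nat -> set nat -> set nat -> Prop) (phi : formula AP) :
    Prop :=
  exists m I E L, G m I E L /\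
    (forall v, v < m -> exists w, w < m /\ E (v * m + w)) /\
    (exists v, v < m /\ I v) /\
    exists Y, (forall X, Y X <-> exists R, Rrun n.+1 m I E L X R) /\
      sat (@decs n Y) (@empty_assignment _) 0 phi.

(** The condition on [Y] determines it: it consists of the codes of the traces of the system. *)
Lemma represents_models m I E L (S : tsystem AP 'I_m) phi : represents I E L S ->
  (exists Y, (forall X, Y X <-> exists R, Rrun n.+1 m I E L X R) /\
     sat (@decs n Y) (@empty_assignment _) 0 phi) <-> models (traces S) phi.
Proof.
move=> rS; have eqT Y : (forall X, Y X <-> exists R, Rrun n.+1 m I E L X R) ->
    @decs n Y = traces S.
  by move=> YP; apply/seteqP; split=> t; rewrite /decs /= YP (run_traces _ rS) encK.
split=> [[Y [YP]]|h]; first by rewrite eqT.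
by exists [set X | exists R, Rrun n.+1 m I E L X R]; split=> //; rewrite eqT.
Qed.

(** These three sets form the canonical representation of [S]: they contain no numbers but codes, so
    the guard can prescribe them completely. *)
Definition sys_init m (S : tsystem AP 'I_m) : set nat :=
  [set k | exists2 v, v \in init S & k = val v].
Definition sys_edge m (S : tsystem AP 'I_m) : set nat :=
  [set k | exists v, exists2 w, edge S v w & k = v * m + w].
Definition sys_label m (S : tsystem AP 'I_m) : set nat :=
  [set k | exists v, exists2 p, p \in label S v & k = v * n.+1 + p].

Lemma represents_sys m (S : tsystem AP 'I_m) :
  represents (sys_init S) (sys_edge S) (sys_label S) S.
Proof.
split=> [v|v w|v p]; split.
- by case=> v' v'I /val_inj->.
- by exists v.
- by case=> v' [w' h /mixed_radix_inj[/val_inj-> ->]].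
- by exists v, w.
- by case=> v' [w' h /mixed_radix_inj[/val_inj-> ->]].
- by exists v, p.
Qed.

Lemma Rsystem_sys G phi m (S : tsystem AP 'I_m) :
  G m (sys_init S) (sys_edge S) (sys_label S) -> models (traces S) phi -> Rsystem G phi.
Proof.
move=> hG hS; exists m, (sys_init S), (sys_edge S), (sys_label S); split=> //.
split=> [v vm|].
  have [w vw] := edge_total S (Ordinal vm).
  by exists w; split=> //; exists (Ordinal vm), w.
split; last exact/(represents_models _ (represents_sys S)).
by have [v vI] := init_nonempty S; exists v; split=> //; exists v.
Qed.

Lemma traces_ord (V : finType) (S : tsystem AP V) :
  exists S' : tsystem AP 'I_#|V|, traces S' = traces S.
Proof.
have tot (v : 'I_#|V|) : exists w : 'I_#|V|, edge S (enum_val v) (enum_val w).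
  by have [w vw] := edge_total S (enum_val v); exists (enum_rank w); rewrite enum_rankK.
have ini : exists v : 'I_#|V|, v \in [set v | enum_val v \in init S]%SET.
  by have [v vI] := init_nonempty S; exists (enum_rank v); rewrite inE enum_rankK.
pose S' := @TSystem AP 'I_#|V| (fun v w => edge S (enum_val v) (enum_val w))
  [set v | enum_val v \in init S]%SET (fun v => label S (enum_val v)) tot ini.
exists S'; apply/seteqP; split=> t [rho [rho0 rhoS] ->].
  exists (fun i => enum_val (rho i)) => //; split=> //.
  by move: rho0; rewrite inE.
exists (fun i => enum_rank (rho i)); last by apply/funext => i /=; rewrite enum_rankK.
by split=> [|i] /=; rewrite ?inE !enum_rankK.
Qed.

(** The trivial guard [0 = 0] is the meaning of [z = z] in [upper_fs]. A system on any finite type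
    is renumbered; conversely a tuple satisfying the conditions of totality and nonemptiness is read
    as a system. *)
Lemma Rsystem_finite_state phi : Rsystem (fun _ _ _ _ => 0 = 0) phi <->
  exists (V : finType) (S : tsystem AP V), models (traces S) phi.
Proof.
split=> [[m [I [E [L [_ [tot [ini h]]]]]]]|[V [S hS]]]; last first.
  by have [S' eqS] := traces_ord S; apply: (@Rsystem_sys _ _ _ S'); rewrite // eqS.
have tot' (v : 'I_m) : exists w : 'I_m, `[< E (v * m + w) >].
  by have [w [wm h']] := tot v (ltn_ord v); exists (Ordinal wm); apply/asboolP.
have ini' : exists v : 'I_m, v \in [set v : 'I_m | `[< I v >]]%SET.
  by have [v [vm h']] := ini; exists (Ordinal vm); rewrite inE; apply/asboolP.
pose S := @TSystem AP 'I_m (fun v w => `[< E (v * m + w) >]) [set v : 'I_m | `[< I v >]]%SET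
  (fun v => [set p : AP | `[< L (v * n.+1 + p) >]]%SET) tot' ini'.
have rS : represents I E L S by split=> [v|v w|v p]; rewrite ?inE.
by exists 'I_m, S; apply/(represents_models phi rS).
Qed.

Section Spec.
Variables (z o h : tree).

Lemma aspec_system s guard G phi : base n z o h s -> scoped [::] phi ->
  (forall s' m I E L m' I' E' L', aext s s' -> nden s' m m' -> sden s' I I' ->
     sden s' E E' -> sden s' L L' -> aspec s' (guard m I E L) (G m' I' E' L')) ->
  aspec s (u_system z o h guard (code_formula phi)) (Rsystem G phi).
Proof.
move=> hb cl hG; rewrite /u_system /Rsystem.
apply: aspec_ex0 => s1 m m' e1 hm; apply: aspec_ex1 => s2 I I' e2 hI.
apply: aspec_ex1 => s3 E E' e3 hE; apply: aspec_ex1 => s4 L L' e4 hL.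
have e := aext_trans (aext_trans (aext_trans e1 e2) e3) e4.
have {}hb := base_ext e hb; have [hz ho hh] := hb.
have {}hm : nden s4 m m' by eauto with aden nocore.
have {}hI : sden s4 I I' by eauto with aden nocore.
have {}hE : sden s4 E E' by eauto with aden nocore.
clear s1 s2 s3 e1 e2 e3 e4.
apply: aspec_and; first exact: hG.
apply: aspec_and; first by repeat aspec_step.
apply: aspec_and; first by repeat aspec_step.
apply: aspec_ex2 => s1 T Y e1 hT; apply: aspec_and; last first.
  by apply: (aspec_form cl) => //; apply: base_ext e1 hb.
apply: aspec_all1 => s2 X X' e2 hX; apply: aspec_iffP; first by aspec_step.
apply: aspec_ex1 => s3 R R' e3 hR.
by apply: aspec_run; eauto 6 with aden nocore.
Qed.

End Spec.
End Systems.

(** * Describing a given transition system in arithmetic *)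

Section Lists.
Variables (z o : tree) (s : astate).
Hypotheses (hz : nden s z 0) (ho : nden s o 1).

Lemma aspec_list b k b' k' l : nden s b b' -> nden s k k' ->
  aspec s (u_list z o b k (code_nats l)) (exists2 a, a \in l & k' = b' + a).
Proof.
move=> hb hk; elim: l => [|a l IH].
  apply: (@aspec_iff _ _ (~ (0 = 0))); first by split=> // -[].
  by apply: aspec_not; apply: aspec_eq.
apply: (@aspec_iff _ _ (k' = b' + a \/ exists2 a, a \in l & k' = b' + a)).
  split=> [[->|[a' la' ->]]|[a']]; first by exists a; rewrite ?inE ?eqxx.
    by exists a'; rewrite ?inE ?la' ?orbT.
  by rewrite inE => /orP[/eqP-> |]; [left | right; exists a'].
apply: aspec_or IH; apply: aspec_eq => //; apply: nden_add => //.
exact: nden_num.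
Qed.

(** The induction needs an arbitrary start [v] of the row counter, which becomes the offset [v'] of
    the row indices. *)
Lemma aspec_rows (X : Type) (F : X -> tree) (g : X -> seq nat) pr m k m' k' xs :
  (forall x, pr (F x) = code_nats (g x)) -> nden s m m' -> nden s k k' ->
  forall v v', nden s v v' ->
  aspec s (u_rows z o m k pr (code_seq (map F xs)) v)
    (exists i x, onth xs i = Some x /\ exists2 a, a \in g x & k' = (v' + i) * m' + a).
Proof.
move=> prF hm hk; elim: xs => [|x xs IH] v v' hv.
  apply: (@aspec_iff _ _ (~ (0 = 0))); first by split=> // -[[|i] [x []]].
  by apply: aspec_not; apply: aspec_eq.
have IHv := IH _ _ (nden_add hv ho).
have hx : aspec s (u_list z o (umul v m) k (pr (F x)))
    (exists2 a, a \in g x & k' = v' * m' + a).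
  by rewrite prF; apply: aspec_list => //; apply: nden_mul.
apply: aspec_iff (aspec_or hx IHv).
split=> [[[a ga ->]|[i [y [xi [a ga ->]]]]]|[[|i] [y [xi [a ga ->]]]]].
- by exists 0, x; split=> //; exists a; rewrite ?addn0.
- by exists i.+1, y; split=> //; exists a; rewrite // addn1 addSnnS.
- by left; case: xi ga => <-; exists a; rewrite ?addn0.
- by right; exists i, y; split=> //; exists a; rewrite // addn1 addSnnS.
Qed.

End Lists.

Lemma onth_enum_ord m i (v : 'I_m) : onth (enum 'I_m) i = Some v <-> i = v.
Proof.
have lt : i < m = onth (enum 'I_m) i by rewrite onthTE size_enum_ord.
split=> [e|->].
  have im : i < m by rewrite lt e.
  by rewrite -{1}(nth_enum_ord v im) (@onth_nth _ v _ _ _ e).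
have : onth (enum 'I_m) v by rewrite onthTE size_enum_ord.
by case e: (onth _ _) => [u|] // _; rewrite -(@onth_nth _ v _ _ _ e) nth_ord_enum.
Qed.

Lemma aspec_guard n m (S : tsystem 'I_n.+1 'I_m) z o h s d I E L d' I' E' L' :
  base n z o h s -> nden s d d' -> sden s I I' -> sden s E E' -> sden s L L' ->
  aspec s (u_guard z o h (code_tsystem S) d I E L)
    (d' = m /\ I' = sys_init S /\ E' = sys_edge S /\ L' = sys_label S).
Proof.
move=> [hz ho hh] hd hI hE hL; rewrite /u_guard.
(* The formula codes edges with its own variable as radix; the first conjunct identifies the value
   [d'] of that variable with [m]. *)
apply: (@aspec_iff _ _ (d' = m /\ I' = sys_init S /\
    E' = [set k | exists v, exists2 w, edge S v w & k = v * d' + w] /\ L' = sys_label S)).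
  by split=> -[-> [-> [-> ->]]].
pose F v := Node (code_nats [seq val w | w <- enum 'I_m & edge S v w])
                 (code_nats [seq val p | p <- enum 'I_n.+1 & p \in label S v]).
have iffE (A B : set nat) : A = B <-> forall k, A k <-> B k.
  by split=> [-> //|e]; apply/seteqP; split=> k /e.
apply: aspec_and.
  rewrite -[X in _ = X](size_enum_ord m) -(size_map F).
  by apply: aspec_eq => //; apply: nden_size.
have rowE d0 k (g : 'I_m -> seq nat) :
    (exists i v, onth (enum 'I_m) i = Some v /\ exists2 a, a \in g v & k = (0 + i) * d0 + a) <->
    exists (v : 'I_m), exists2 a, a \in g v & k = v * d0 + a.
  split=> [[i [v [/onth_enum_ord-> [a ga ->]]]]|[v [a ga ->]]]; first by exists v, a.
  by exists v, v; split; [apply/onth_enum_ord | exists a].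
apply: aspec_and.
  apply: aspec_iff (iff_sym (iffE _ _)) _; apply: aspec_all0 => s' d0 k e hk.
  apply: aspec_iffP; first by aspec_step.
  apply: (@aspec_iff _ _ (exists2 a,
      a \in [seq val v | v <- enum 'I_m & v \in init S] & k = 0 + a)).
    split=> [[a /mapP[v]]|[v vI ->]]; last first.
      by exists (val v) => //; apply: map_f; rewrite mem_filter vI mem_enum.
    by rewrite mem_filter => /andP[vI _] -> ->; exists v.
  exact: (@aspec_list _ _ _ (nden_ext e hz) (nden_ext e ho) _ _ _ _
    [seq val v | v <- enum 'I_m & v \in init S] (nden_ext e hz) hk).
apply: aspec_and.
  apply: aspec_iff (iff_sym (iffE _ _)) _; apply: aspec_all0 => s' d0 k e hk.
  apply: aspec_iffP; first by aspec_step.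
  have {e hk}[hk hz' ho' hd'] : [/\ nden s' d0 k, nden s' z 0, nden s' o 1 & nden s' d d'].
    by split=> //; apply: nden_ext e _.
  apply: aspec_iff (aspec_rows (F := F) hz' ho'
    (g := fun v => [seq val w | w <- enum 'I_m & edge S v w]) _ _ hd' hk hz'); last by [].
  rewrite rowE; split=> [[v [a /mapP[w]]]|[v [w vw ->]]].
    by rewrite mem_filter => /andP[vw _] -> ->; exists v, w.
  by exists v, (val w) => //; apply: map_f; rewrite mem_filter vw mem_enum.
apply: aspec_iff (iff_sym (iffE _ _)) _; apply: aspec_all0 => s' d0 k e hk.
apply: aspec_iffP; first by aspec_step.
have {e hk}[hk hz' ho' hh'] : [/\ nden s' d0 k, nden s' z 0, nden s' o 1 & nden s' h n.+1].
  by split=> //; apply: nden_ext e _.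
apply: aspec_iff (aspec_rows (F := F) hz' ho'
  (g := fun v => [seq val p | p <- enum 'I_n.+1 & p \in label S v]) _ _ hh' hk hz'); last by [].
rewrite rowE; split=> [[v [a /mapP[p]]]|[v [p vp ->]]].
  by rewrite mem_filter => /andP[vp _] -> ->; exists v, p.
by exists v, (val p) => //; apply: map_f; rewrite mem_filter vp mem_enum.
Qed.

(** * The upper bounds *)

Definition astart : astate :=
  AState 0 [::] [::] [::] (fun=> 0) (fun=> set0) (fun=> set0).

Lemma aspec_sentence D P : aspec astart D P ->
  exists phi : asentence, code_aformula (asentence_formula phi) = D Leaf /\
    (P <-> atrue (asentence_formula phi)).
Proof.
have va : avalid astart by [].
move=> /(_ _ (aext_refl va))[f [cf sf satP]].
by exists (ASentence sf); rewrite /atrue -satP.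
Qed.

Lemma satisfiability_le_third_order : reducible satisfiability third_order_truth.
Proof.
apply: (reducible_by real_upper_sat) => -[n phi cl] /=.
apply: aspec_sentence; apply: aspec_top => s z o e hz ho.
have hb : base n z o (uadd o (u_num z o (code_nat n))) s.
  by split=> //; apply: (nden_add ho); apply: nden_num.
apply: (@aspec_iff _ _ (exists Y, (exists A, Y A) /\
    sat (@decs n Y) (@empty_assignment _) 0 phi)).
  split=> [[Y [[A YA] h]]|[T [[t Tt] h]]].
    by exists (@decs n Y); split=> //; exists (dec n A); rewrite /decs /= decK.
  have eqT : decs [set A | T (dec n A)] = T.
    by apply/seteqP; split=> u; rewrite /decs /= encK.
  exists [set A | T (dec n A)]; rewrite eqT; split=> //.
  by exists (enc t); rewrite /= encK.
apply: aspec_ex2 => s1 T Y e1 hT; apply: aspec_and; first by repeat aspec_step.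
by apply: (aspec_form cl) => //; apply: base_ext e1 hb.
Qed.

Lemma finite_state_satisfiability_le_third_order :
  reducible finite_state_satisfiability third_order_truth.
Proof.
apply: (reducible_by real_upper_fs) => -[n phi cl] /=.
apply: aspec_sentence; apply: aspec_top => s z o e hz ho.
apply: aspec_iff (Rsystem_finite_state _) _.
apply: aspec_system => // [|s' m I E L m' I' E' L' e' *].
  by split=> //; apply: (nden_add ho); apply: nden_num.
by apply: aspec_eq; apply: nden_ext e' hz.
Qed.

(** The guard leaves the canonical tuple of the input system as the only candidate, so the
    existential quantifiers act as a definite description. *)
Lemma model_checking_le_third_order : reducible model_checking third_order_truth.
Proof.
apply: (reducible_by real_upper_mc) => -[[n phi cl] m S] /=.
apply: aspec_sentence; apply: aspec_top => s z o e hz ho.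
have hb : base n z o (uadd o (u_num z o (code_nat n))) s.
  by split=> //; apply: (nden_add ho); apply: nden_num.
apply: (@aspec_iff _ _ (Rsystem (fun m' I E L => m' = m /\ I = sys_init S /\
    E = sys_edge S /\ L = sys_label S) phi)).
  split=> [[m' [I [E [L [[-> [-> [-> ->]]] [_ [_]]]]]]]|h].
    by move/(represents_models _ (represents_sys S)).
  exact: (@Rsystem_sys _ _ _ _ S).
apply: aspec_system => // s' d I E L d' I' E' L' e' *.
by apply: aspec_guard => //; apply: base_ext e' hb.
Qed.

Theorem theorem7 :
  equivalent satisfiability third_order_truth
  /\ equivalent finite_state_satisfiability third_order_truth
  /\ equivalent model_checking third_order_truth.
Proof.
split; last split.
- exact: conj satisfiability_le_third_order third_order_le_satisfiability.
- exact: conj finite_state_satisfiability_le_third_order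
              third_order_le_finite_state_satisfiability.
- exact: conj model_checking_le_third_order third_order_le_model_checking.
Qed.
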